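(* Let $G=\langle a,b\mid a^2=1,\ b^3=1\rangle\cong \operatorname{PSL}_2\mathbb{Z}$ and let $\mathcal{L}$ be the bounded self-adjoint operator on $\ell^2(G)$ given by $$(\mathcal{L} f)(x)=f(x)-\tfrac12 f(xa)-\tfrac14 f(xb)-\tfrac14 f(xb^{-1}),\qquad x\in G.$$ Then the spectrum of $\mathcal{L}$ is $$\operatorname{Sp}(\mathcal{L})=\Big[\lambda_0,\tfrac74-\lambda_1\Big]\sqcup\Big\{\tfrac{3}{4}\Big\}\sqcup\Big[\lambda_1,\tfrac74-\lambda_0\Big]\sqcup\Big\{\tfrac{7}{4}\Big\},$$ where $$\lambda_0=\frac78-\frac12\sqrt{\frac{25}{16}+\sqrt{2}},\qquad \lambda_1=\frac78+\frac12\sqrt{\frac{25}{16}-\sqrt{2}}.$$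
   Context: $\mathcal{L}$ is the normalized Laplacian of the Cayley graph of $G$ with respect to the generators $a,b$, with double edges for the generator $a$ of order two. *)

(* Defs.v *)
From HB Require Import structures.
From mathcomp Require Import all_boot all_order all_algebra.
From mathcomp Require Import generic_quotient complex ring lra.
From mathcomp Require Import all_classical all_reals all_analysis.

Set Implicit Arguments.
Unset Strict Implicit.
Unset Printing Implicit Defensive.

Import Order.TTheory GRing.Theory Num.Theory.
Import numFieldNormedType.Exports.

Local Open Scope classical_set_scope.
Local Open Scope ring_scope.
Local Open Scope quotient_scope.

Section Presentation.
Variables (S : choiceType) (rels : set (seq (S * bool))).

(* A letter [(s, false)] stands for the generator [s], and [(s, true)] for its
   formal inverse. *)
Local Notation word := (seq (S * bool)).

Inductive pres_rel : word -> word -> Prop :=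
| pres_refl u : pres_rel u u
| pres_sym u v : pres_rel u v -> pres_rel v u
| pres_trans u v w : pres_rel u v -> pres_rel v w -> pres_rel u w
| pres_cat u u' v v' :
    pres_rel u u' -> pres_rel v v' -> pres_rel (u ++ v) (u' ++ v')
| pres_cancel s e : pres_rel [:: (s, e); (s, ~~ e)] [::]
| pres_relator r : rels r -> pres_rel r [::].

Definition pres_relb : rel word := fun u v => `[< pres_rel u v >].

Lemma pres_relb_refl : reflexive pres_relb.
Proof. by move=> u; apply/asboolP; exact: pres_refl. Qed.

Lemma pres_relb_sym : symmetric pres_relb.
Proof. by move=> u v; apply/asboolP/asboolP; exact: pres_sym. Qed.

Lemma pres_relb_trans : transitive pres_relb.
Proof.
by move=> v u w /asboolP uv /asboolP vw; apply/asboolP; exact: pres_trans vw.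
Qed.

Canonical pres_equiv :=
  EquivRel pres_relb pres_relb_refl pres_relb_sym pres_relb_trans.

Definition presented_group := {eq_quot pres_equiv}.
HB.instance Definition _ := Choice.on presented_group.
HB.instance Definition _ := EqQuotient.on presented_group.

Definition pres_class (u : word) : presented_group := \pi_presented_group u.

Lemma pres_classP u v : pres_class u = pres_class v <-> pres_rel u v.
Proof.
split; first by move/eqP; rewrite /pres_class eqmodE => /asboolP.
by move=> uv; apply/eqP; rewrite /pres_class eqmodE; apply/asboolP.
Qed.

Lemma pres_classK (g : presented_group) : pres_class (repr g) = g.
Proof. exact: reprK. Qed.

Definition winv (u : word) : word := rev [seq (l.1, ~~ l.2) | l <- u].

Lemma winvK : involutive winv.
Proof.
move=> u; rewrite /winv map_rev revK -map_comp -[RHS]map_id.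
by apply: eq_map => -[s e] /=; rewrite negbK.
Qed.

Lemma pres_mulwV u : pres_rel (u ++ winv u) [::].
Proof.
elim: u => [|[s e] u IH]; first exact: pres_refl.
rewrite /winv /= rev_cons -cats1 -/(winv u).
rewrite -[_ :: _]/([:: (s, e)] ++ u ++ (winv u ++ [:: (s, ~~ e)])).
apply: (@pres_trans _ ([:: (s, e)] ++ [::] ++ [:: (s, ~~ e)])).
  apply: pres_cat; first exact: pres_refl.
  by rewrite catA; apply: pres_cat => //; exact: pres_refl.
exact: pres_cancel.
Qed.

Lemma pres_mulVw u : pres_rel (winv u ++ u) [::].
Proof. by have := pres_mulwV (winv u); rewrite winvK. Qed.

Lemma pres_winv u v : pres_rel u v -> pres_rel (winv u) (winv v).
Proof.
move=> uv; apply: (@pres_trans _ (winv u ++ (v ++ winv v))).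
  rewrite -[X in pres_rel X _]cats0; apply: pres_cat; first exact: pres_refl.
  exact/pres_sym/pres_mulwV.
rewrite catA -[X in pres_rel _ X]cat0s.
apply: pres_cat; last exact: pres_refl.
apply: (@pres_trans _ (winv u ++ u)); last exact: pres_mulVw.
by apply: pres_cat; [exact: pres_refl|exact: pres_sym].
Qed.

Definition pres_one : presented_group := pres_class [::].
Definition pres_mul (g h : presented_group) : presented_group :=
  pres_class (repr g ++ repr h).
Definition pres_inv (g : presented_group) : presented_group :=
  pres_class (winv (repr g)).

Lemma pres_class_cat u v :
  pres_class (u ++ v) = pres_mul (pres_class u) (pres_class v).
Proof. by apply/pres_classP/pres_cat; apply/pres_classP; rewrite pres_classK. Qed.

Lemma pres_class_winv u : pres_class (winv u) = pres_inv (pres_class u).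
Proof. by apply/pres_classP/pres_winv; apply/pres_classP; rewrite pres_classK. Qed.

Lemma pres_mulA : associative pres_mul.
Proof.
move=> x y z; rewrite -(pres_classK x) -(pres_classK y) -(pres_classK z).
by rewrite -!pres_class_cat catA.
Qed.

Lemma pres_mul1 : left_id pres_one pres_mul.
Proof. by move=> x; rewrite -(pres_classK x) -pres_class_cat. Qed.

Lemma pres_mulr1 : right_id pres_one pres_mul.
Proof. by move=> x; rewrite -(pres_classK x) -pres_class_cat cats0. Qed.

Lemma pres_mulV : left_inverse pres_one pres_inv pres_mul.
Proof.
move=> x; rewrite -(pres_classK x) -pres_class_winv -pres_class_cat.
exact/pres_classP/pres_mulVw.
Qed.

Lemma pres_mulrV : right_inverse pres_one pres_inv pres_mul.
Proof.
move=> x; rewrite -(pres_classK x) -pres_class_winv -pres_class_cat.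
exact/pres_classP/pres_mulwV.
Qed.

HB.instance Definition _ := isGroup.Build presented_group
  pres_mulA pres_mul1 pres_mulr1 pres_mulV pres_mulrV.

Definition pres_gen (s : S) : presented_group := pres_class [:: (s, false)].

End Presentation.

Section Ell2.
Variables (R : realType) (T : choiceType).
Implicit Types f g : T -> R[i].

Definition sqsum f : \bar R := \esum_(x in [set: T]) (Normc.normc (f x) ^+ 2)%:E.

Definition ell2_pred : {pred T -> R[i]} := [pred f | `[< (sqsum f < +oo)%E >]].

Lemma ell2_predP f : reflect (sqsum f < +oo)%E (f \in ell2_pred).
Proof. by rewrite inE; exact: asboolP. Qed.

Lemma normc_ge0 (z : R[i]) : 0 <= Normc.normc z.
Proof. by case: z => a b /=; exact: sqrtr_ge0. Qed.

Lemma sqsum_ge0 f : (0 <= sqsum f)%E.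
Proof. by apply: esum_ge0 => x _; rewrite lee_fin sqr_ge0. Qed.

Lemma sqsum_fin f : f \in ell2_pred -> sqsum f \is a fin_num.
Proof. by move=> /ell2_predP foo; rewrite ge0_fin_numE ?sqsum_ge0. Qed.

Lemma esum_scale_le (c : R) (F : T -> R) : 0 <= c -> (forall x, 0 <= F x) ->
  (\esum_(x in [set: T]) (c * F x)%:E <= c%:E * \esum_(x in [set: T]) (F x)%:E)%E.
Proof.
move=> c0 F0; apply: ge_ereal_sup => _ [A [finA _] <-].
under eq_fsbigr do rewrite EFinM.
rewrite -ge0_mule_fsumr; last by move=> x; rewrite lee_fin.
by apply: lee_wpmul2l; [rewrite lee_fin|apply: esum_ge; exists A].
Qed.

Lemma sqsumZ_le (l : R[i]) f :
  (sqsum (l *: f)%R <= (Normc.normc l ^+ 2)%:E * sqsum f)%E.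
Proof.
have sq0 x : 0 <= Normc.normc (f x) ^+ 2 by exact: sqr_ge0.
apply: (le_trans _ (esum_scale_le (sqr_ge0 _) sq0)).
apply: le_esum => x _; rewrite lee_fin -exprMn -Normc.normcM.
exact: lexx.
Qed.

Lemma sqsum0 : sqsum 0 = 0%E.
Proof.
apply: esum1 => x _; rewrite -[X in Normc.normc X]/(0 : R[i]).
by rewrite Normc.normc0 expr0n.
Qed.

Lemma sqsumZ (l : R[i]) f : sqsum (l *: f)%R = ((Normc.normc l ^+ 2)%:E * sqsum f)%E.
Proof.
have [->|l0] := eqVneq l 0.
  by rewrite scale0r sqsum0 Normc.normc0 expr0n mul0e.
have nl0 : Normc.normc l != 0 by apply: contra_neq l0; exact: Normc.eq0_normc.
apply/le_anti; rewrite sqsumZ_le /=.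
have := sqsumZ_le l^-1 (l *: f); rewrite scalerA mulVf// scale1r => le_f.
apply: (le_trans (lee_wpmul2l _ le_f)); first by rewrite lee_fin sqr_ge0.
by rewrite muleA -EFinM Normc.normcV -exprMn mulfV// expr1n mul1e.
Qed.

Lemma sqsumD_le f g (t : R) : 0 < t ->
  (sqsum (f + g)%R <= (1 + t)%:E * sqsum f + (1 + t^-1)%:E * sqsum g)%E.
Proof.
move=> t0; have ti0 : 0 < t^-1 by rewrite invr_gt0.
have c0 : 0 <= 1 + t by rewrite addr_ge0// ltW.
have d0 : 0 <= 1 + t^-1 by rewrite addr_ge0// ltW.
have sq0 (h : T -> R[i]) x : 0 <= Normc.normc (h x) ^+ 2 by exact: sqr_ge0.
have := leeD (esum_scale_le c0 (sq0 f)) (esum_scale_le d0 (sq0 g)).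
rewrite -!/(sqsum _); apply: le_trans.
rewrite -esumD; last 2 first.
- by move=> x _; rewrite lee_fin mulr_ge0.
- by move=> x _; rewrite lee_fin mulr_ge0.
apply: le_esum => x _; rewrite -EFinD lee_fin.
have := le_normcD (f x) (g x); rewrite -[f x + g x]/((f + g) x).
move: (normc_ge0 (f x)) (normc_ge0 (g x)) (normc_ge0 ((f + g) x)).
move: (Normc.normc _) (Normc.normc _) (Normc.normc _) => w v u u0 v0 w0 wuv.
apply: (@le_trans _ _ ((u + v) ^+ 2)); first by rewrite ler_sqr ?nnegrE ?addr_ge0.
rewrite -subr_ge0.
have -> : (1 + t) * u ^+ 2 + (1 + t^-1) * v ^+ 2 - (u + v) ^+ 2 =
  t^-1 * (t * u - v) ^+ 2 by field; rewrite gt_eqF.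
by rewrite mulr_ge0 ?sqr_ge0// ltW.
Qed.

Lemma ell2_submod_closed : submod_closed ell2_pred.
Proof.
split; first by apply/ell2_predP; rewrite sqsum0.
move=> l f g /ell2_predP foo /ell2_predP goo; apply/ell2_predP.
apply: (le_lt_trans (sqsumD_le _ _ ltr01)).
rewrite sqsumZ; apply: lte_add_pinfty; rewrite ?lte_mul_pinfty ?mule_ge0 ?lee_fin ?sqr_ge0//.
Qed.

HB.instance Definition _ :=
  GRing.isSubmodClosed.Build _ _ ell2_pred ell2_submod_closed.

Record ell2 := Ell2 { ell2_fun :> T -> R[i]; _ : ell2_fun \in ell2_pred }.
HB.instance Definition _ := [isSub for ell2_fun].
HB.instance Definition _ := [Choice of ell2 by <:].
HB.instance Definition _ := [SubChoice_isSubLmodule of ell2 by <:].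

Lemma ell2_mem (f : ell2) : (f : T -> R[i]) \in ell2_pred.
Proof. exact: (valP f). Qed.

Definition ell2_rnorm (f : ell2) : R := Num.sqrt (fine (sqsum f)).

Lemma ell2_rnorm_ge0 (f : ell2) : 0 <= ell2_rnorm f.
Proof. exact: sqrtr_ge0. Qed.

Lemma ell2_rnormE (f : ell2) : sqsum f = (ell2_rnorm f ^+ 2)%:E.
Proof.
by rewrite sqr_sqrtr ?fine_ge0 ?sqsum_ge0// fineK// sqsum_fin// ell2_mem.
Qed.

Lemma ell2_rnorm_eq0 (f : ell2) : ell2_rnorm f = 0 -> f = 0.
Proof.
move=> f0; apply/val_inj/funext => x; apply/Normc.eq0_normc/eqP.
rewrite -sqrf_eq0 -eqe; apply/eqP/le_anti/andP; split; last by rewrite lee_fin sqr_ge0.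
have <- : sqsum f = 0%:E by rewrite ell2_rnormE f0 expr0n.
by apply: esum_ge; exists [set x]; [split|rewrite fsbig_set1].
Qed.

Lemma ell2_rnormZ (l : R[i]) (f : ell2) :
  ell2_rnorm (l *: f) = Normc.normc l * ell2_rnorm f.
Proof.
apply/eqP; rewrite -(@eqrXn2 _ 2) ?mulr_ge0 ?ell2_rnorm_ge0 ?normc_ge0//.
by rewrite -eqe -ell2_rnormE (sqsumZ l f) ell2_rnormE -EFinM exprMn.
Qed.

Lemma ell2_rnormD (f g : ell2) : ell2_rnorm (f + g) <= ell2_rnorm f + ell2_rnorm g.
Proof.
have [/ell2_rnorm_eq0 -> |f0] := eqVneq (ell2_rnorm f) 0.
  by rewrite add0r lerDr ell2_rnorm_ge0.
have [/ell2_rnorm_eq0 -> |g0] := eqVneq (ell2_rnorm g) 0.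
  by rewrite addr0 lerDl ell2_rnorm_ge0.
have pf : 0 < ell2_rnorm f by rewrite lt_def f0 ell2_rnorm_ge0.
have pg : 0 < ell2_rnorm g by rewrite lt_def g0 ell2_rnorm_ge0.
rewrite -ler_sqr ?nnegrE ?addr_ge0 ?ell2_rnorm_ge0// -lee_fin -ell2_rnormE.
apply: (le_trans (sqsumD_le f g (divr_gt0 pg pf))).
rewrite !ell2_rnormE -!EFinM -EFinD lee_fin le_eqVlt; apply/orP; left.
by apply/eqP; field; rewrite f0 g0.
Qed.

(* The norm of a [normedModType] over [R[i]] takes its values in [R[i]]. *)
Definition ell2_norm (f : ell2) : R[i] := (ell2_rnorm f)%:C%C.

Lemma ell2_normD (f g : ell2) : ell2_norm (f + g) <= ell2_norm f + ell2_norm g.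
Proof. by rewrite -rmorphD lecR ell2_rnormD. Qed.

Lemma ell2_normZ (l : R[i]) (f : ell2) : ell2_norm (l *: f) = `|l| * ell2_norm f.
Proof. by rewrite /ell2_norm ell2_rnormZ rmorphM; case: l. Qed.

Lemma ell2_norm_eq0 (f : ell2) : ell2_norm f = 0 -> f = 0.
Proof. by move=> [/ell2_rnorm_eq0]. Qed.

HB.instance Definition _ :=
  Lmodule_isNormed.Build R[i] ell2 ell2_normD ell2_normZ ell2_norm_eq0.

End Ell2.

Section Spectrum.
Variables (K : numFieldType) (V : normedModType K).

(* A linear operator between normed modules is bounded iff it is continuous
   ([linear_bounded_continuous]); [z] is in the resolvent set of [A] iff
   [A - z] has a bounded two-sided inverse. *)
Definition resolvent_set (A : {linear V -> V}) : set K :=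
  [set z | exists B : {linear V -> V}, [/\ continuous B,
     forall v, B (A v - z *: v) = v & forall v, A (B v) - z *: B v = v]].

Definition spectrum (A : {linear V -> V}) : set K := ~` resolvent_set A.

End Spectrum.

Section Laplacian.
Variables (R : realType) (G : groupType).
Local Notation l2G := (ell2 R G).

Lemma sqsum_rtransl (g : G) (f : G -> R[i]) :
  sqsum (fun x => f (x * g)%g) = sqsum f.
Proof.
rewrite /sqsum [RHS](reindex_esum [set: G] [set: G] (fun x => x * g)%g)//.
by split => // [x y _ _ /mulIg//|y _]; exists (y * g^-1)%g => //; rewrite -mulgA mulVg mulg1.
Qed.

Lemma rtransl_subproof (g : G) (f : l2G) :
  (fun x => f (x * g)%g) \in @ell2_pred R G.
Proof. by apply/ell2_predP; rewrite sqsum_rtransl; apply/ell2_predP/ell2_mem. Qed.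

Definition rtransl (g : G) (f : l2G) : l2G := Ell2 (rtransl_subproof g f).

Lemma rtransl_linear g : linear (rtransl g).
Proof. by move=> l u v; exact/val_inj/funext. Qed.

HB.instance Definition _ g :=
  GRing.isLinear.Build R[i] l2G l2G _ (rtransl g) (rtransl_linear g).

Lemma ell2_norm_rtransl g (f : l2G) : `|rtransl g f| = `|f|.
Proof. by congr (_%:C)%C; rewrite /ell2_rnorm sqsum_rtransl. Qed.

(* The normalized Laplacian of the Cayley graph of [G] with respect to [a] (of
   order two, counted as a double edge) and [b]. *)
Definition laplacian (a b : G) (f : l2G) : l2G :=
  f - 2^-1 *: rtransl a f - 4^-1 *: rtransl b f - 4^-1 *: rtransl b^-1%g f.

Lemma laplacianE a b (f : l2G) x : laplacian a b f x =
  f x - 2^-1 * f (x * a)%g - 4^-1 * f (x * b)%g - 4^-1 * f (x * b^-1)%g.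
Proof. by []. Qed.

Lemma laplacian_linear a b : linear (laplacian a b).
Proof.
move=> l u v; apply/val_inj/funext => x.
change (laplacian a b (l *: u + v) x =
  l * laplacian a b u x + laplacian a b v x).
rewrite !laplacianE.
have E y : ell2_fun (l *: u + v) y = l * u y + v y by [].
by rewrite !E; ring.
Qed.

HB.instance Definition _ a b :=
  GRing.isLinear.Build R[i] l2G l2G _ (laplacian a b) (laplacian_linear a b).

Lemma laplacian_continuous a b : continuous (laplacian a b).
Proof.
apply: bounded_linear_continuous; apply/linear_boundedP.
near=> r => f; apply: (@le_trans _ _ (2 * `|f|)); last first.
  by apply: ler_wpM2r => //; near: r; apply: nbhs_pinfty_ge; rewrite realn.
rewrite /laplacian (le_trans (ler_normB _ _))//.
have -> : 2 * `|f| = `|f| + 2^-1 * `|f| + 4^-1 * `|f| + 4^-1 * `|f|.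
  by field.
rewrite lerD//; last by rewrite normrZ ell2_norm_rtransl ger0_norm ?invr_ge0.
rewrite (le_trans (ler_normB _ _))// lerD//; last first.
  by rewrite normrZ ell2_norm_rtransl ger0_norm ?invr_ge0.
rewrite (le_trans (ler_normB _ _))// lerD//.
by rewrite normrZ ell2_norm_rtransl ger0_norm ?invr_ge0.
Unshelve. all: by end_near. Qed.
End Laplacian.

(* [G = < a, b | a ^ 2 = 1, b ^ 3 = 1 >], with generators indexed by [bool]:
   [false] for [a] and [true] for [b]. *)
Definition modular_rels : set (seq (bool * bool)) :=
  [set nseq 2 (false, false); nseq 3 (true, false)].

Definition modular_group : groupType := presented_group modular_rels.

Definition modular_a : modular_group := pres_gen modular_rels false.
Definition modular_b : modular_group := pres_gen modular_rels true.

Lemma modular_a2 : (modular_a * modular_a = 1)%g.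
Proof.
rewrite -[LHS]pres_class_cat; apply/pres_classP.
by apply: pres_relator; left.
Qed.

Lemma modular_b3 : (modular_b * modular_b * modular_b = 1)%g.
Proof.
rewrite -[X in (X * _)%g]pres_class_cat -[LHS]pres_class_cat.
by apply/pres_classP; apply: pres_relator; right.
Qed.

Definition lambda0 (R : realType) : R :=
  7 / 8 - 2^-1 * Num.sqrt (25 / 16 + Num.sqrt 2).

Definition lambda1 (R : realType) : R :=
  7 / 8 + 2^-1 * Num.sqrt (25 / 16 - Num.sqrt 2).

(* Main.v *)
(* Write [A], [B] for the right translations by [a], [b] and [P] for the average
   [(1 + B + B^-1) / 3], so that [L = 5 / 4 - A / 2 - 3 P / 4].
   The Schur complement of [z - L] with respect to the range of [P] is
   [z - 5 / 4 + A / 2], singular only at [z = 3 / 4] and [z = 7 / 4], and it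
   reduces [z - L] to [t - 3 P A] with [t = 8 (z - 7 / 8) ^ 2 - 25 / 8], where
   [3 P A] is the adjacency operator of the trivalent tree of cosets of [<b>].
   Choosing an end of the tree gives each vertex one parent and two children,
   and splits the adjacency operator as [S + S*] with [S* S = 2].
   If [t = 2 al + 1 / al] then [al (t - S - S* ) = (1 - al S* ) (1 - al S)],
   which is invertible by Neumann series when [2 |al| ^ 2 < 1] and is not
   bounded below when [2 |al| ^ 2 = 1], that is, when [t] is real with
   [|t| <= 2 sqrt 2]. Finally [3 / 4] and [7 / 4] are eigenvalues. *)

Require Import Defs.
From HB Require Import structures.
From mathcomp Require Import all_boot all_order all_algebra.
From mathcomp Require Import complex.
From mathcomp Require Import all_classical all_reals all_analysis.
From mathcomp Require Import ring lra.

Set Implicit Arguments.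
Unset Strict Implicit.
Unset Printing Implicit Defensive.

Import Order.TTheory GRing.Theory Num.Theory.
Import numFieldNormedType.Exports.

Local Open Scope classical_set_scope.
Local Open Scope ring_scope.

(** * Bounded invertibility and the resolvent set on [ell2] *)

Section Ell2Operators.
Variables (R : realType) (T : choiceType).
Local Notation H := (ell2 R T).
Local Notation N := (@ell2_rnorm R T).
Local Notation normc := (@Normc.normc R).
Implicit Types (f g h : H) (X Y : H -> H).

(** Bounded below and onto, stated for bare functions: no inverse has to be built as a linear map,
    which keeps compositions light. *)
Definition invertible X :=
  (exists C : R, forall f, N f <= C * N (X f)) /\ (forall g, exists f, X f = g).

Lemma ell2_ext f g : f =1 g -> f = g.
Proof. by move=> fg; apply/val_inj/funext. Qed.

Lemma ell2D f g x : (f + g) x = f x + g x. Proof. by []. Qed.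
Lemma ell2N f x : (- f) x = - f x. Proof. by []. Qed.
Lemma ell2Z (l : R[i]) f x : (l *: f) x = l * f x. Proof. by []. Qed.
Definition ell2E := (ell2D, ell2N, ell2Z).

Lemma ell2_rnorm0 : N 0 = 0.
Proof. by rewrite /ell2_rnorm (sqsum0 R T) sqrtr0. Qed.

Lemma ell2_rnormN f : N (- f) = N f.
Proof.
by rewrite -scaleN1r ell2_rnormZ /= oppr0 expr0n addr0 sqrrN expr1n sqrtr1 mul1r.
Qed.

Lemma ell2_rnormB f g : N (f - g) <= N f + N g.
Proof. by rewrite (le_trans (ell2_rnormD _ _))// ell2_rnormN. Qed.

(** The lower bound gives injectivity, so a chosen preimage depends linearly on its argument; the
    same bound makes this inverse continuous. *)
Lemma resolvent_ell2P (A : {linear H -> H}) (z : R[i]) :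
  resolvent_set A z <-> invertible (fun f => A f - z *: f).
Proof.
split=> [[B [Bc BA AB]]|[[C Cle] sur]].
  split; last by move=> g; exists (B g).
  have /linear_bounded_continuous/linear_boundedP := Bc.
  move=> [r0 [r0r /(_ (`|r0| + 1))]].
  have /[swap] /[apply] : r0 < `|r0| + 1.
    by apply: (le_lt_trans (real_ler_norm r0r)); rewrite ltrDl.
  move=> Br; exists (complex.Re (`|r0| + 1)) => f.
  rewrite -lecR rmorphM /=.
  have -> : (complex.Re (`|r0| + 1))%:C%C = `|r0| + 1.
    by rewrite RRe_real // ger0_real// addr_ge0.
  by have := Br (A f - z *: f); rewrite BA.
have Ylin l u v : A (l *: u + v) - z *: (l *: u + v) =
    l *: (A u - z *: u) + (A v - z *: v).
  rewrite linearP scalerDr scalerA [z * l]mulrC -scalerA opprD addrACA.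
  by rewrite scalerBr.
pose b g : H := projT1 (cid (sur g)).
have bE g : A (b g) - z *: b g = g by rewrite /b; case: cid.
have inj f g : A f - z *: f = A g - z *: g -> f = g.
  move=> fg; apply/eqP; rewrite -subr_eq0; apply/eqP/ell2_rnorm_eq0/le_anti.
  rewrite ell2_rnorm_ge0 andbT (le_trans (Cle _))//.
  have -> : f - g = -1 *: g + f by rewrite scaleN1r addrC.
  by rewrite Ylin fg scaleN1r addNr ell2_rnorm0 mulr0.
have blin : linear b by move=> l u v; apply: inj; rewrite Ylin !bE.
pose B : {linear H -> H} := HB.pack b (GRing.isLinear.Build _ _ _ _ b blin).
exists B; split => //; last by move=> v; apply: inj; exact: bE.
apply: bounded_linear_continuous; apply/linear_boundedP.
near=> r => f; apply: (@le_trans _ _ (C%:C%C * `|f|)).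
  by rewrite -[X in X <= _]/((N (b f))%:C%C) -rmorphM lecR -[f in leRHS]bE Cle.
apply: ler_wpM2r => //; near: r; apply: nbhs_pinfty_ge.
by rewrite realE -(rmorph0 (real_complex R)) !lecR le_total.
Unshelve. all: by end_near. Qed.

End Ell2Operators.

(** * Limits of geometrically Cauchy sequences of numbers *)

Section GeometricConvergence.
Variable R : realType.
Local Notation normc := (@Normc.normc R).

(** With [K = C / (1 - q)], [u n - K q ^ n] increases, [u n + K q ^ n] decreases, and the first
    stays below the second; the supremum of the first is the limit, with its rate. *)
Lemma geometric_cauchy (u : nat -> R) (C q : R) : 0 <= C -> 0 <= q < 1 ->
  (forall n, `|u n.+1 - u n| <= C * q ^+ n) ->
  exists l, forall n, `|l - u n| <= C / (1 - q) * q ^+ n.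
Proof.
move=> C0 /andP[q0 q1] uC; set K := C / (1 - q).
have q1' : 0 < 1 - q by rewrite subr_gt0.
have K0 : 0 <= K by rewrite divr_ge0// ltW.
have KC n : C * q ^+ n = K * q ^+ n - K * q ^+ n.+1.
  by rewrite exprS /K; field; rewrite gt_eqF.
have Kq n : 0 <= K * q ^+ n by rewrite mulr_ge0// exprn_ge0.
have lo_nd : {homo (fun n => u n - K * q ^+ n) : n m / (n <= m)%N >-> n <= m}.
  apply: homo_leq => // [x y z|n]; first exact: le_trans.
  by have := uC n; rewrite KC ler_norml => /andP[? _]; lra.
have hi_ni : {homo (fun n => - (u n + K * q ^+ n)) : n m / (n <= m)%N >-> n <= m}.
  apply: homo_leq => // [x y z|n]; first exact: le_trans.
  by have := uC n; rewrite KC ler_norml => /andP[_ ?]; lra.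
have lohi n m : u n - K * q ^+ n <= u m + K * q ^+ m.
  have h1 := lo_nd _ _ (leq_maxl n m); have h2 := hi_ni _ _ (leq_maxr n m).
  by have := Kq (maxn n m); lra.
pose E := range (fun n => u n - K * q ^+ n).
have Eub : has_ubound E by exists (u 0 + K * q ^+ 0) => _ [n _ <-].
exists (sup E) => n; rewrite ler_distl; apply/andP; split.
  by apply: ub_le_sup => //; exists n.
apply: ge_sup; first by exists (u 0 - K * q ^+ 0); exists 0.
by move=> _ [m _ <-].
Qed.

Lemma le_of_geometric (x a b q : R) : 0 <= q < 1 ->
  (forall n, x <= a + b * q ^+ n) -> x <= a.
Proof.
move=> /andP[q0 q1] xab.
have : a + b * q ^+ n @[n --> \oo] --> a + b * 0.
  apply: cvgD; first exact: cvg_cst.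
  by apply: cvgM; [exact: cvg_cst | apply: cvg_expr; rewrite ger0_norm].
by rewrite mulr0 addr0 => /cvgr_to_ge; apply; exact: nearW.
Qed.

Lemma normc_Re_Im (z : R[i]) :
  [/\ `|complex.Re z| <= normc z, `|complex.Im z| <= normc z &
      normc z <= `|complex.Re z| + `|complex.Im z|].
Proof.
case: z => a b /=; split.
- by rewrite -sqrtr_sqr ler_wsqrtr// lerDl sqr_ge0.
- by rewrite -sqrtr_sqr ler_wsqrtr// lerDr sqr_ge0.
rewrite -[leRHS]ger0_norm ?addr_ge0// -sqrtr_sqr ler_wsqrtr//.
rewrite sqrrD !real_normK ?num_real//.
by have := mulr_ge0 (normr_ge0 a) (normr_ge0 b); lra.
Qed.

Lemma geometric_cauchyC (u : nat -> R[i]) (C q : R) : 0 <= C -> 0 <= q < 1 ->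
  (forall n, normc (u n.+1 - u n) <= C * q ^+ n) ->
  exists l, forall n, normc (l - u n) <= 2 * (C / (1 - q)) * q ^+ n.
Proof.
move=> C0 q01 uC.
have ReB (z w : R[i]) : complex.Re z - complex.Re w = complex.Re (z - w).
  by case: z w => ? ? [].
have ImB (z w : R[i]) : complex.Im z - complex.Im w = complex.Im (z - w).
  by case: z w => ? ? [].
have [//|//|n|lr lrP] := @geometric_cauchy (fun n => complex.Re (u n)) C q.
  by rewrite ReB; case: (normc_Re_Im (u n.+1 - u n)) => + _ _; move/le_trans; exact.
have [//|//|n|li liP] := @geometric_cauchy (fun n => complex.Im (u n)) C q.
  by rewrite ImB; case: (normc_Re_Im (u n.+1 - u n)) => _ + _; move/le_trans; exact.
exists (lr +i* li)%C => n; have [_ _ /le_trans] := normc_Re_Im ((lr +i* li)%C - u n).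
apply; rewrite -ReB -ImB /= -mulrA mulr_natl mulr2n lerD//.
Qed.

End GeometricConvergence.

(** * Completeness of [ell2] and the Neumann series *)

Section Ell2Complete.
Variables (R : realType) (T : choiceType).
Local Notation H := (ell2 R T).
Local Notation N := (@ell2_rnorm R T).
Local Notation normc := (@Normc.normc R).
Implicit Types (f g h : H).

Lemma le_sqsum (f g : T -> R[i]) :
  (forall x, normc (f x) <= normc (g x)) -> (sqsum f <= sqsum g)%E.
Proof.
move=> fg; apply: le_esum => x _.
by rewrite lee_fin ler_sqr ?nnegrE ?normc_ge0.
Qed.

Lemma sqsum_const_lty (A : set T) (c : R[i]) : finite_set A ->
  (sqsum (fun x => if x \in A then c else 0%R) < +oo)%E.
Proof.
move=> finA; rewrite /sqsum.
rewrite (eq_esum (b := fun x => if x \in A then (normc c ^+ 2)%:E else 0%E)).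
  rewrite -esum_mkcond esum_fset//; last by move=> x _; rewrite lee_fin sqr_ge0.
  by rewrite fsumEFin// ltry.
by move=> x _; case: ifP => // _; rewrite Normc.normc0 expr0n.
Qed.

Lemma sqsum_le_finite (f : T -> R[i]) (M : \bar R) :
  (forall A, finite_set A ->
    (sqsum (fun x => if x \in A then f x else 0%R) <= M)%E) -> (sqsum f <= M)%E.
Proof.
move=> fM; apply: ge_ereal_sup => _ [A [finA _] <-].
rewrite -esum_fset//; last by move=> x _; rewrite lee_fin sqr_ge0.
rewrite esum_mkcond; apply: le_trans (fM A finA); apply: le_esum => x _.
by case: ifP => // _; rewrite Normc.normc0 expr0n.
Qed.

Lemma normc_le_rnorm f x : normc (f x) <= N f.
Proof.
rewrite -ler_sqr ?nnegrE ?normc_ge0 ?ell2_rnorm_ge0// -lee_fin -ell2_rnormE.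
by apply: esum_ge; exists [set x]; [split|rewrite fsbig_set1].
Qed.

(** The limit is taken pointwise. Its rate is uniform over [T], hence need not be summable there, so
    the error is first estimated on finite sets. *)
Lemma ell2_complete (s : nat -> H) (C q : R) : 0 <= C -> 0 <= q < 1 ->
  (forall n, N (s n.+1 - s n) <= C * q ^+ n) ->
  exists l : H, exists K : R, forall n, N (l - s n) <= K * q ^+ n.
Proof.
move=> C0 /[dup] q01 /andP[q0 q1] sC; set K := C / (1 - q).
have q1' : 0 < 1 - q by rewrite subr_gt0.
have K0 : 0 <= K by rewrite divr_ge0// ltW.
have Kq n : 0 <= K * q ^+ n by rewrite mulr_ge0// exprn_ge0.
have /choice[l lP] : forall x, exists lx : R[i], forall n,
    normc (lx - s n x) <= 2 * K * q ^+ n.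
  move=> x; apply: geometric_cauchyC => // n.
  by rewrite -[_ - _]/((s n.+1 - s n) x) (le_trans (normc_le_rnorm _ _)).
have sK n k : N (s (n + k)%N - s n) <= K * q ^+ n - K * q ^+ (n + k).
  elim: k => [|k IH]; first by rewrite addn0 !subrr ell2_rnorm0.
  have -> : s (n + k.+1)%N - s n =
      (s (n + k).+1 - s (n + k)%N) + (s (n + k)%N - s n).
    by rewrite addnS addrA subrK.
  apply: (le_trans (ell2_rnormD _ _)); have := sC (n + k)%N.
  have -> : C * q ^+ (n + k) = K * q ^+ (n + k) - K * q ^+ (n + k.+1).
    by rewrite addnS exprS /K; field; rewrite gt_eqF.
  by lra.
(* On a finite set, [l - s n] is split at [s (n + m)]: one piece is bounded in norm by [K q ^ n],
   the other pointwise, at the cost of a factor counting the set, and it vanishes as [m] grows. *)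
have key n : (sqsum (fun x => l x - s n x)%R <= (2 * (K * q ^+ n) ^+ 2)%:E)%E.
  apply: sqsum_le_finite => A finA.
  pose I : T -> R[i] := fun x => if x \in A then 1 else 0.
  have Ifin : (sqsum I < +oo)%E by exact: sqsum_const_lty.
  have Ifn : sqsum I \is a fin_num by rewrite ge0_fin_numE ?sqsum_ge0.
  pose b := fine (sqsum I); have Ib : sqsum I = b%:E by rewrite /b fineK.
  set F := fun x => _.
  have step m : (sqsum F <=
      (2 * (K * q ^+ n) ^+ 2 + 2 * (2 * K) ^+ 2 * b * (q ^+ 2) ^+ m)%:E)%E.
    pose d : R[i] := (2 * K * q ^+ m)%:C%C.
    have d0 : normc d = 2 * K * q ^+ m.
      by rewrite /d /= expr0n addr0 sqrtr_sqr ger0_norm// -mulrA mulr_ge0.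
    pose F1 : T -> R[i] := fun x => if x \in A then (s (n + m)%N - s n) x else 0.
    pose F2 : T -> R[i] := fun x => if x \in A then l x - s (n + m)%N x else 0.
    have -> : F = F1 + F2.
      apply/funext => x; rewrite -[RHS]/(F1 x + F2 x) /F /F1 /F2.
      by case: ifP => _; rewrite ?addr0// !ell2E; ring.
    apply: (le_trans (sqsumD_le F1 F2 (@ltr01 R))).
    rewrite invr1 [leRHS]EFinD; apply: leeD.
      rewrite EFinM -[(1 + 1 : R)]/(2%:R); apply: lee_wpmul2l => //.
      apply: (@le_trans _ _ (sqsum (s (n + m)%N - s n))).
        apply: le_sqsum => x; rewrite /F1; case: ifP => // _.
        by rewrite Normc.normc0 normc_ge0.
      rewrite ell2_rnormE lee_fin ler_sqr ?nnegrE ?ell2_rnorm_ge0//.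
      by rewrite (le_trans (sK _ _))// gerBl.
    rewrite -!mulrA EFinM -[(1 + 1 : R)]/(2%:R); apply: lee_wpmul2l => //.
    apply: (@le_trans _ _ (sqsum (d *: I))).
      apply: le_sqsum => x; rewrite /F2 -[(d *: I) x]/(d * I x) /I; case: ifP => _.
        rewrite mulr1 d0; apply: (le_trans (lP _ _)).
        apply: ler_wpM2l; first by rewrite mulr_ge0.
        by rewrite exprD ler_piMl ?exprn_ge0// exprn_ile1// ltW.
      by rewrite mulr0.
    rewrite sqsumZ d0 Ib -EFinM lee_fin exprAC le_eqVlt; apply/orP; left.
    by apply/eqP; rewrite /K; ring.
  have Ffin : sqsum F \is a fin_num.
    by rewrite ge0_fin_numE ?sqsum_ge0// (le_lt_trans (step 0%N))// ltry.
  rewrite -(fineK Ffin) lee_fin.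
  apply: (@le_of_geometric _ _ _ (2 * (2 * K) ^+ 2 * b) (q ^+ 2)).
    by rewrite exprn_ge0//= exprn_ilt1.
  by move=> m; have := step m; rewrite -(fineK Ffin) lee_fin.
have lin : l \in @ell2_pred R T.
  have -> : l = (fun x => l x - s 0%N x) + s 0%N.
    by apply/funext => x; rewrite -[RHS]/((l x - s 0%N x) + s 0%N x) subrK.
  apply: rpredD; last exact: ell2_mem.
  by apply/ell2_predP; rewrite (le_lt_trans (key 0%N))// ltry.
exists (Ell2 lin), (2 * K) => n.
rewrite -ler_sqr ?nnegrE ?ell2_rnorm_ge0//; last by rewrite -mulrA mulr_ge0.
rewrite -lee_fin -ell2_rnormE; apply: (le_trans (key n)); rewrite lee_fin.
by rewrite -mulrA [leRHS]exprMn ler_wpM2r ?sqr_ge0//; lra.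
Qed.

(** A preimage of [g] is the limit of the iteration of [g + E f] from [0], that is, the Neumann
    series applied to [g]. *)
Lemma invertible_sub1 (E : {linear H -> H}) (q : R) : 0 <= q < 1 ->
  (forall f, N (E f) <= q * N f) -> invertible (fun f => f - E f).
Proof.
move=> /[dup] q01 /andP[q0 q1] Eq; split.
  exists (1 - q)^-1 => f; rewrite ler_pdivlMl ?subr_gt0//.
  have := ell2_rnormD (f - E f) (E f); rewrite subrK => h.
  by have := Eq f; lra.
move=> g; pose s n := iter n (fun f => g + E f) 0.
have sC n : N (s n.+1 - s n) <= N g * q ^+ n.
  elim: n => [|n IH]; first by rewrite /s /= linear0 addr0 subr0 expr0 mulr1.
  rewrite /s iterS [X in _ - X]iterS -/(s n) -/(s n.+1).
  rewrite opprD addrACA subrr add0r -linearB.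
  by rewrite (le_trans (Eq _))// exprS mulrCA ler_wpM2l.
have [f [K fK]] := ell2_complete (ell2_rnorm_ge0 g) q01 sC.
exists f; apply/eqP; rewrite -subr_eq0; apply/eqP/ell2_rnorm_eq0/le_anti.
rewrite ell2_rnorm_ge0 andbT.
apply: (@le_of_geometric _ _ _ (q * K + K * q) q) => // n; rewrite add0r.
(* The residual does not depend on [n], yet it is a combination of two errors of the iteration,
   which decay geometrically. *)
have -> : f - E f - g = (f - s n.+1) - E (f - s n).
  by rewrite linearB /s iterS -/(s n); apply: ell2_ext => x; rewrite !ell2E; ring.
rewrite (le_trans (ell2_rnormB _ _))//.
have := Eq (f - s n); have := fK n; have := fK n.+1; rewrite exprS => h1 h2 h3.
have := ler_wpM2l q0 h2; nra.
Qed.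

End Ell2Complete.

(** * Binary branchings, the shift and its adjoint *)

(** A bijection from [bool * T] onto [T], with inverse given by [sibling] and [parent]. Every vertex
    has a parent, so there is no root: parents lead towards the chosen end of the tree. *)
Record branching (T : Type) := Branching {
  child : bool -> T -> T;
  parent : T -> T;
  sibling : T -> bool;
  childK : forall b, cancel (child b) parent;
  sibling_child : forall b x, sibling (child b x) = b;
  child_parent : forall x, child (sibling x) (parent x) = x
}.

Section InvertibleTheory.
Variables (R : realType) (T : choiceType).
Local Notation H := (ell2 R T).
Local Notation N := (@ell2_rnorm R T).
Local Notation normc := (@Normc.normc R).
Implicit Types (f g h : H) (X Y : H -> H).

Lemma invertible_comp X Y : invertible X -> invertible Y -> invertible (X \o Y).
Proof.
move=> [[C XC] Xs] [[D YD] Ys]; split; last first.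
  by move=> g; have [f <-] := Xs g; have [h <-] := Ys f; exists h.
exists (`|D| * C) => f; apply: (le_trans (YD f)).
apply: (@le_trans _ _ (`|D| * N (Y f))).
  by rewrite ler_wpM2r ?ell2_rnorm_ge0// ler_norm.
by rewrite -mulrA ler_wpM2l.
Qed.

Lemma invertible_scale (l : R[i]) : l != 0 -> invertible (fun f : H => l *: f).
Proof.
move=> l0; split; last by move=> g; exists (l^-1 *: g); rewrite scalerA mulfV// scale1r.
exists (normc l^-1) => f.
by rewrite -ell2_rnormZ scalerA mulVf// scale1r.
Qed.

End InvertibleTheory.

Section Shift.
Variables (R : realType) (T : choiceType) (tau : branching T).
Local Notation H := (ell2 R T).
Local Notation N := (@ell2_rnorm R T).
Local Notation normc := (@Normc.normc R).
Implicit Types (f g h : H).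

Lemma esum_branching (F : T -> \bar R) : (forall x, (0 <= F x)%E) ->
  (\esum_(x in [set: T]) F x =
   \esum_(x in [set: T]) (F (child tau false x) + F (child tau true x)))%E.
Proof.
move=> F0; rewrite esumD// (esumID [set x | ~~ sibling tau x])//; congr (_ + _)%E.
  rewrite setTI; apply: (@reindex_esum R T T _ _ (child tau false)); split.
  - by move=> x _ /=; rewrite sibling_child.
  - by move=> x y _ _ /(congr1 (parent tau)); rewrite !childK.
  - move=> x /= /negbTE sx; exists (parent tau x) => //.
    by rewrite -sx child_parent.
rewrite setTI; apply: (@reindex_esum R T T _ _ (child tau true)); split.
- by move=> x _ /=; rewrite sibling_child.
- by move=> x y _ _ /(congr1 (parent tau)); rewrite !childK.
- move=> x /= /negP; rewrite negbK => sx; exists (parent tau x) => //.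
  by rewrite -[X in child tau X]sx child_parent.
Qed.

Lemma sqsum_branching (f : T -> R[i]) :
  sqsum f = (sqsum (f \o child tau false) + sqsum (f \o child tau true))%E.
Proof.
rewrite /sqsum esum_branching; last by move=> x; rewrite lee_fin sqr_ge0.
by rewrite esumD// => x _; rewrite lee_fin sqr_ge0.
Qed.

Lemma sqsum_parent (f : T -> R[i]) : sqsum (f \o parent tau) = (sqsum f + sqsum f)%E.
Proof.
by rewrite sqsum_branching; congr (_ + _)%E; congr sqsum;
  apply/funext => x /=; rewrite childK.
Qed.

Lemma shift_subproof f : f \o parent tau \in @ell2_pred R T.
Proof.
apply/ell2_predP; rewrite sqsum_parent.
by apply: lte_add_pinfty; apply/ell2_predP/ell2_mem.
Qed.

Definition shift f : H := Ell2 (shift_subproof f).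

Lemma coshift_subproof f :
  (fun x => f (child tau false x) + f (child tau true x)) \in @ell2_pred R T.
Proof.
have fb b : f \o child tau b \in @ell2_pred R T.
  apply/ell2_predP; apply: (@le_lt_trans _ _ (sqsum f)).
    by rewrite [leRHS]sqsum_branching; case: b; rewrite ?leeDl ?leeDr ?sqsum_ge0.
  exact/ell2_predP/ell2_mem.
exact: (rpredD (fb false) (fb true)).
Qed.

(** The adjoint of [shift], given directly by its formula. *)
Definition coshift f : H := Ell2 (coshift_subproof f).

Lemma twist_subproof f :
  (fun x => if sibling tau x then - f x else f x) \in @ell2_pred R T.
Proof.
apply/ell2_predP; apply: le_lt_trans (elimT (ell2_predP _) (ell2_mem f)).
by apply: le_sqsum => x; case: ifP => // _; rewrite normcN.
Qed.

(** The sign change at one of each two siblings turns functions in the range of [shift] into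
    elements of the kernel of [coshift]. *)
Definition twist f : H := Ell2 (twist_subproof f).

Lemma shiftE f x : shift f x = f (parent tau x). Proof. by []. Qed.

Lemma coshiftE f x : coshift f x = f (child tau false x) + f (child tau true x).
Proof. by []. Qed.

Lemma twistE f x : twist f x = if sibling tau x then - f x else f x.
Proof. by []. Qed.

Lemma shift_linear : linear shift.
Proof. by move=> l u v; exact/val_inj/funext. Qed.

Lemma coshift_linear : linear coshift.
Proof.
by move=> l u v; apply: ell2_ext => x; rewrite !(ell2E, coshiftE); ring.
Qed.

HB.instance Definition _ := GRing.isLinear.Build R[i] H H _ shift shift_linear.
HB.instance Definition _ := GRing.isLinear.Build R[i] H H _ coshift coshift_linear.

Lemma shift_coshift f : coshift (shift f) = 2 *: f.
Proof. by apply: ell2_ext => x; rewrite ell2E coshiftE !shiftE !childK; ring. Qed.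

Lemma coshift_twist f : coshift (twist (shift f)) = 0.
Proof.
apply: ell2_ext => x; rewrite coshiftE !twistE !sibling_child !shiftE !childK.
by rewrite subrr.
Qed.

Lemma rnorm_twist f : N (twist f) = N f.
Proof.
congr (Num.sqrt (fine _)); apply: eq_esum => x _.
by rewrite twistE; case: ifP => // _; rewrite normcN.
Qed.

Lemma sqr_rnorm_shift f : N (shift f) ^+ 2 = 2 * N f ^+ 2.
Proof.
by apply/EFin_inj; rewrite -ell2_rnormE sqsum_parent ell2_rnormE -EFinD mulr_natl mulr2n.
Qed.

Lemma sqr_rnorm_coshift f : N (coshift f) ^+ 2 <= 2 * N f ^+ 2.
Proof.
rewrite -lee_fin -ell2_rnormE EFinM -ell2_rnormE (sqsum_branching f).
have := sqsumD_le (f \o child tau false) (f \o child tau true) (@ltr01 R).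
by rewrite invr1 -[(1 + 1 : R)]/(2%:R) -ge0_muleDr ?sqsum_ge0.
Qed.

Lemma scaled_rnorm_le (X : H -> H) (l : R[i]) :
  (forall f, N (X f) ^+ 2 <= 2 * N f ^+ 2) ->
  forall f, N (l *: X f) <= Num.sqrt (2 * normc l ^+ 2) * N f.
Proof.
move=> X2 f; rewrite -ler_sqr ?nnegrE ?mulr_ge0 ?sqrtr_ge0 ?ell2_rnorm_ge0//.
have l2 : 0 <= 2 * normc l ^+ 2 by rewrite mulr_ge0 ?sqr_ge0.
rewrite ell2_rnormZ !exprMn (sqr_sqrtr l2).
by rewrite [leRHS]mulrAC [leRHS]mulrC ler_wpM2l ?sqr_ge0.
Qed.

(** The only product in the expansion is [coshift (shift f)], equal to [2 f], which accounts for the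
    coefficient [2 al]. *)
Lemma shift_factor (al : R[i]) f : al != 0 ->
  let h := f - al *: shift f in
  al *: ((2 * al + al^-1) *: f - shift f - coshift f) = h - al *: coshift h.
Proof.
move=> al0 h.
have -> : coshift h = coshift f - al *: (2 *: f).
  by rewrite /h linearB linearZ; congr (_ - _ *: _); exact: shift_coshift.
by apply: ell2_ext => x; rewrite /h !ell2E; field.
Qed.

Lemma invertible_resolvent_shift (al : R[i]) : al != 0 -> 2 * normc al ^+ 2 < 1 ->
  invertible (fun f : H => (2 * al + al^-1) *: f - shift f - coshift f).
Proof.
move=> al0 al2; set q := Num.sqrt (2 * normc al ^+ 2).
have q01 : 0 <= q < 1.
  by rewrite sqrtr_ge0 -[ltRHS]sqrtr1 ltr_sqrt.
have linS : linear (fun f => al *: shift f).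
  by move=> l u v; rewrite linearP scalerDr !scalerA mulrC.
have linC : linear (fun f => al *: coshift f).
  by move=> l u v; rewrite linearP scalerDr !scalerA mulrC.
pose S : {linear H -> H} := HB.pack (fun f => al *: shift f)
  (GRing.isLinear.Build _ _ _ _ _ linS).
pose C : {linear H -> H} := HB.pack (fun f => al *: coshift f)
  (GRing.isLinear.Build _ _ _ _ _ linC).
have S2 f : N (shift f) ^+ 2 <= 2 * N f ^+ 2 by rewrite sqr_rnorm_shift.
(* Both factors differ from the identity by an operator of norm at most [q], as [shift] and
   [coshift] have norm at most [sqrt 2]. *)
have iS := @invertible_sub1 R T S q q01
  (scaled_rnorm_le al S2).
have iC := @invertible_sub1 R T C q q01 (scaled_rnorm_le al sqr_rnorm_coshift).
have alV0 : al^-1 != 0 by rewrite invr_eq0.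
have := invertible_comp (invertible_scale T alV0) (invertible_comp iC iS).
set X := (_ \o _); set Y := fun _ => _; suff -> : X = Y by [].
apply/funext => f; rewrite /X /Y /= -shift_factor//.
by rewrite scalerA mulVf// scale1r.
Qed.

(** Orthogonality of the range of [shift] and the kernel of [coshift], checked on each pair of
    siblings: there [g] takes opposite values and [shift h] equal ones, so the parallelogram law
    applies. *)
Lemma sqr_rnormD_shift (al : R[i]) g h : 2 * normc al ^+ 2 = 1 -> coshift g = 0 ->
  N (g + al *: shift h) ^+ 2 = N g ^+ 2 + N h ^+ 2.
Proof.
move=> al2 g0; apply/EFin_inj; rewrite EFinD -!ell2_rnormE.
rewrite /sqsum esum_branching; last by move=> x; rewrite lee_fin sqr_ge0.
rewrite [in RHS]esum_branching; last by move=> x; rewrite lee_fin sqr_ge0.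
rewrite -esumD; last 2 first.
- by move=> x _; rewrite -EFinD lee_fin addr_ge0 ?sqr_ge0.
- by move=> x _; rewrite lee_fin sqr_ge0.
apply: eq_esum => x _; rewrite -!EFinD; congr EFin.
have /eqP : coshift g x = 0 by rewrite g0.
rewrite coshiftE addr_eq0 => /eqP gx; rewrite !ell2E !shiftE !childK gx.
move: (g (child tau true x)) => p.
have -> : normc (h x) ^+ 2 = 2 * normc (al * h x) ^+ 2.
  by rewrite Normc.normcM exprMn mulrA al2 mul1r.
move: (al * h x) => w; case: p w => [a b] [c d] /=.
by rewrite !sqr_sqrtr ?addr_ge0 ?sqr_ge0//; ring.
Qed.

(* The partial sums of the Neumann series of [(1 - al S)^-1 g] grow like
   [sqrt n], because the terms are orthogonal when [S* g = 0]; their images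
   under [(1 - al S* ) (1 - al S)] stay bounded by telescoping. *)
Lemma shift_not_bounded_below (al : R[i]) g (D : H -> Prop) :
  2 * normc al ^+ 2 = 1 -> coshift g = 0 -> g != 0 -> D 0 ->
  (forall h, D h -> D (g + al *: shift h)) ->
  ~ exists C : R, forall u, D u ->
    N u <= C * N ((2 * al + al^-1) *: u - shift u - coshift u).
Proof.
move=> al2 g0 gn0 D0 Dg [C DC].
have al0 : al != 0.
  apply/eqP => al0; move: al2; rewrite al0 Normc.normc0 expr0n mulr0.
  by move/esym/eqP; rewrite oner_eq0.
(* [u n] is the sum of [(al S) ^ k g] over [k < n], and [w n] is the next term [(al S) ^ n g]. *)
pose u n := iter n (fun h => g + al *: shift h) 0.
pose w n := iter n (fun h => al *: shift h) g.
have Du n : D (u n) by elim: n => //= n; exact: Dg.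
have uN n : N (u n) ^+ 2 = n%:R * N g ^+ 2.
  elim: n => [|n IH]; first by rewrite ell2_rnorm0 expr0n mul0r.
  by rewrite /= sqr_rnormD_shift// IH -[in RHS]natr1 mulrDl mul1r addrC.
have wN n : N (w n) = N g.
  elim: n => //= n <-; apply/eqP; rewrite -(@eqrXn2 _ 2) ?ell2_rnorm_ge0//.
  by rewrite ell2_rnormZ exprMn sqr_rnorm_shift mulrCA mulrA al2 mul1r.
have uw n : u n - al *: shift (u n) = g - w n.
  elim: n => [|n IH]; first by rewrite /= linear0 scaler0 !subrr.
  rewrite /= -/(u n) -/(w n); have -> : w n = g - (u n - al *: shift (u n)).
    by rewrite IH opprB addrC subrK.
  by apply: ell2_ext => x; rewrite !(ell2E, shiftE); ring.
have bnd n : N (al *: ((2 * al + al^-1) *: u n - shift (u n) - coshift (u n))) <= 4 * N g.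
  rewrite shift_factor// uw; apply: (le_trans (ell2_rnormB _ _)).
  have := scaled_rnorm_le al sqr_rnorm_coshift (g - w n).
  rewrite al2 sqrtr1 mul1r; have := ell2_rnormB g (w n); rewrite wN; lra.
have alp : 0 < normc al.
  by rewrite lt_def normc_ge0 andbT; apply/eqP => /Normc.eq0_normc; apply/eqP.
pose M := `|C| * (normc al)^-1 * 4.
have gp : 0 < N g.
  rewrite lt_def ell2_rnorm_ge0 andbT; apply: contra_neq gn0; exact: ell2_rnorm_eq0.
have uM n : N (u n) <= M * N g.
  apply: (le_trans (DC _ (Du n))); set y := _ - coshift _.
  apply: (@le_trans _ _ (`|C| * N y)).
    by rewrite ler_wpM2r ?ell2_rnorm_ge0// ler_norm.
  rewrite /M -!mulrA ler_wpM2l// ler_pdivlMl//.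
  by have := bnd n; rewrite ell2_rnormZ.
(* Squared, the bound reads [n (N g) ^ 2 <= M ^ 2 (N g) ^ 2], which fails once [n] exceeds
   [M ^ 2]. *)
have := uM (Num.truncn (M ^+ 2)).+1.
set n := (Num.truncn _).+1.
have M2 : M ^+ 2 < n%:R by rewrite truncnS_gt.
have M0 : 0 <= M.
  by apply: mulr_ge0 => //; apply: mulr_ge0 => //; rewrite invr_ge0 ltW.
have Mg0 : 0 <= M * N g by rewrite (mulr_ge0 M0) ?ell2_rnorm_ge0.
rewrite leNgt -ltr_sqr ?nnegrE ?ell2_rnorm_ge0//.
by rewrite uN exprMn ltr_pM2r ?exprn_gt0// M2.
Qed.

End Shift.

(** * The action of the modular group on states, and the branching it induces *)

Section ModularGroup.
Local Open Scope group_scope.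
Local Notation G := modular_group.
Local Notation a := modular_a.
Local Notation b := modular_b.
Implicit Types (x : G) (p : option bool) (t : nat -> bool).

Definition rot p :=
  match p with None => Some false | Some false => Some true | Some true => None end.

(* The triangles [x <b>] are the vertices of a trivalent tree, with an end
   fixed once and for all. The first component of a state says which of the
   three edges at a triangle the current element sits at: [None] for the one
   leading towards the end, [Some c] for the one leading to the child [c]. The
   stream records which child of its parent each successive ancestor is. *)
Definition flip (s : option bool * (nat -> bool)) : option bool * (nat -> bool) :=
  match s with
  | (None, t) => (Some (t 0%N), fun n => t n.+1)
  | (Some c, t) => (None, fun n => if n is m.+1 then t m else c)
  end.

(** [flip] stands for both [a] and its inverse, and [rot] applied twice for the inverse of [b]. *)
Definition act_letter s (l : bool * bool) :=
  if l.1 then (if l.2 then rot (rot s.1) else rot s.1, s.2) else flip s.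

Definition act_word := foldl act_letter.

Lemma flipK : involutive flip.
Proof.
case=> [[c|] t] //=; congr (_, _); apply/funext; by case.
Qed.

(** The relators hold because [flip] is an involution and [rot] has order three. The resulting
    action of the group gives the tree and its end without normal forms of words. *)
Lemma act_word_rel u v : pres_rel modular_rels u v ->
  forall s, act_word s u = act_word s v.
Proof.
elim=> {u v} [//|u v _ IH s|u v w _ IHu _ IHv s|u u' v v' _ IHu _ IHv s|[] [] s|r].
- by rewrite IH.
- by rewrite IHu.
- by rewrite /act_word !foldl_cat -!/(act_word _ _) IHu IHv.
- by case: s => [[[]|] t].
- by case: s => [[[]|] t].
- exact: flipK.
- exact: flipK.
case=> -> s /=; first exact: flipK.
by case: s => [[[]|] t].
Qed.

(** The constant stream fixes the end: the base triangle and all its ancestors are [false]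
    children. *)
Definition state x := act_word (None, fun=> false) (repr x).

Lemma state_mul x u : state (x * pres_class modular_rels u) = act_word (state x) u.
Proof.
rewrite /state -[x in LHS](pres_classK x) -[_ * _]pres_class_cat.
have /act_word_rel -> : pres_rel modular_rels
    (repr (pres_class modular_rels (repr x ++ u))) (repr x ++ u).
  by apply/pres_classP; rewrite pres_classK.
by rewrite /act_word foldl_cat.
Qed.

Definition pos x := (state x).1.
Definition rotg p : G :=
  match p with None => 1 | Some false => b | Some true => b^-1 end.

Lemma modular_aK x : x * a * a = x.
Proof. by rewrite -mulgA modular_a2 mulg1. Qed.

Lemma modular_bV : b^-1 = b * b.
Proof. by apply: (mulgI b); rewrite mulgV mulgA modular_b3. Qed.

Lemma state_a x : state (x * a) = flip (state x).
Proof. exact: state_mul. Qed.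

Lemma pos_b x : pos (x * b) = rot (pos x).
Proof. by rewrite /pos state_mul. Qed.

Lemma pos_bV x : pos (x * b^-1) = rot (rot (pos x)).
Proof. by rewrite modular_bV mulgA !pos_b. Qed.

Lemma pos_rotg x p : pos x = None -> pos (x * rotg p) = p.
Proof.
by move=> x0; case: p => [[]|] /=; rewrite ?mulg1// ?pos_bV ?pos_b x0.
Qed.

Lemma rotg_rot p : rotg (rot p) = rotg p * b.
Proof. by case: p => [[]|] /=; rewrite ?mul1g ?mulVg ?modular_bV. Qed.

(** The corner of the triangle of [x] that faces the end. *)
Definition exit x := x * (rotg (pos x))^-1.

Lemma exitK x : exit x * rotg (pos x) = x.
Proof. by rewrite /exit -mulgA mulVg mulg1. Qed.

Lemma pos_exit x : pos (exit x) = None.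
Proof.
rewrite /exit; case E : (pos x) => [[]|] /=.
- by rewrite invgK pos_b E.
- by rewrite pos_bV E.
by rewrite invg1 mulg1.
Qed.

Lemma exit_rotg x p : pos x = None -> exit (x * rotg p) = x.
Proof. by move=> x0; rewrite /exit pos_rotg// -mulgA mulgV mulg1. Qed.

Lemma exit_b x : exit (x * b) = exit x.
Proof. by rewrite /exit pos_b rotg_rot invgM mulgA -[x * b * b^-1]mulgA mulgV mulg1. Qed.

Lemma exit_id x : pos x = None -> exit x = x.
Proof. by move=> x0; rewrite /exit x0 /= invg1 mulg1. Qed.

Lemma pos_a x c : pos x = Some c -> pos (x * a) = None.
Proof. by rewrite /pos state_a; case: (state x) => [[]]. Qed.

(** The edge from the exit arrives at a child position of the parent triangle, so the default
    [false] is never reached, as [pos_exit_a] shows. *)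
Definition gsibling x := odflt false (pos (exit x * a)).

Lemma pos_exit_a x : pos (exit x * a) = Some (gsibling x).
Proof.
rewrite /gsibling; have := pos_exit x; rewrite /pos state_a.
by case: (state _) => [[]].
Qed.

(** The moves go between triangles but keep the position of [x]. They thus form a branching of the
    group itself that commutes with right multiplication by [b], and functions on the tree become
    [b]-invariant functions. *)
Definition gchild c x := exit x * rotg (Some c) * a * rotg (pos x).
Definition gparent x := exit (exit x * a) * rotg (pos x).

Lemma pos_gchild_exit c x : pos (exit x * rotg (Some c) * a) = None.
Proof. by apply: (@pos_a _ c); rewrite pos_rotg ?pos_exit. Qed.

Lemma pos_gparent x : pos (gparent x) = pos x.
Proof. by rewrite pos_rotg ?pos_exit. Qed.

Lemma exit_gparent x : exit (gparent x) = exit (exit x * a).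
Proof. by rewrite exit_rotg ?pos_exit. Qed.

Lemma pos_gchild c x : pos (gchild c x) = pos x.
Proof. by rewrite pos_rotg ?pos_gchild_exit. Qed.

Lemma exit_gchild c x : exit (gchild c x) = exit x * rotg (Some c) * a.
Proof. by rewrite exit_rotg ?pos_gchild_exit. Qed.

Lemma gchildK c : cancel (gchild c) gparent.
Proof.
move=> x; rewrite /gparent pos_gchild exit_gchild modular_aK.
by rewrite exit_rotg ?pos_exit// exitK.
Qed.

Lemma gsibling_gchild c x : gsibling (gchild c x) = c.
Proof. by rewrite /gsibling exit_gchild modular_aK pos_rotg ?pos_exit. Qed.

Lemma gchild_gparent x : gchild (gsibling x) (gparent x) = x.
Proof.
by rewrite /gchild exit_gparent pos_gparent -pos_exit_a exitK modular_aK exitK.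
Qed.

Lemma gchild_b c x : gchild c (x * b) = gchild c x * b.
Proof. by rewrite /gchild exit_b pos_b rotg_rot mulgA. Qed.

Lemma gparent_b x : gparent (x * b) = gparent x * b.
Proof. by rewrite /gparent exit_b pos_b rotg_rot mulgA. Qed.

Lemma pos1 : pos 1 = None.
Proof.
rewrite /pos /state (act_word_rel (v := [::]))//.
by apply/pres_classP; rewrite pres_classK.
Qed.

Definition modular_branching : branching G :=
  Branching gchildK gsibling_gchild gchild_gparent.

End ModularGroup.

(** * The Laplacian on the modular group and its reduction to the tree *)

Section ModularLaplacian.
Variable R : realType.
Local Notation G := modular_group.
Local Notation a := modular_a.
Local Notation b := modular_b.
Local Notation H := (ell2 R G).
Local Notation N := (@ell2_rnorm R G).
Local Notation normc := (@Normc.normc R).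
Local Notation L := (@laplacian R G a b).
Local Notation S := (shift modular_branching).
Local Notation C := (coshift modular_branching).
Implicit Types (f g h u : H) (x : G) (c z : R[i]).

Lemma normc_nat n : normc (n%:R : R[i]) = n%:R.
Proof. by rewrite (normcMn 1 n) Normc.normc1. Qed.

Lemma rtranslE (y : G) f x : rtransl y f x = f (x * y)%g. Proof. by []. Qed.

Lemma rnorm_rtransl (y : G) f : N (rtransl y f) = N f.
Proof. by rewrite /ell2_rnorm sqsum_rtransl. Qed.

Definition avg f : H := 3^-1 *: (f + rtransl b f + rtransl b^-1%g f).

Lemma avgE f x : avg f x = 3^-1 * (f x + f (x * b)%g + f (x * b^-1)%g).
Proof. by []. Qed.

Lemma modular_bK x : ((x * b * b = x * b^-1)%g * (x * b * b^-1 = x)%g *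
  (x * b^-1 * b = x)%g * (x * b^-1 * b^-1 = x * b)%g)%type.
Proof.
have bb y : (y * b * b = y * b^-1)%g by rewrite modular_bV mulgA.
have bV y : (y * b * b^-1 = y)%g by rewrite -mulgA mulgV mulg1.
have Vb y : (y * b^-1 * b = y)%g by rewrite -mulgA mulVg mulg1.
by do !split; rewrite // -bb Vb.
Qed.

Definition simpG := (modular_bK, modular_aK).

Lemma avg_invariant f : rtransl b (avg f) = avg f.
Proof. by apply: ell2_ext => x; rewrite rtranslE !avgE !simpG; ring. Qed.

Lemma rnorm_avg f : N (avg f) <= N f.
Proof.
rewrite ell2_rnormZ Normc.normcV normc_nat ler_pdivrMl//.
have := ell2_rnormD (f + rtransl b f) (rtransl b^-1%g f).
have := ell2_rnormD f (rtransl b f).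
by rewrite !rnorm_rtransl; lra.
Qed.

Section Invariant.
Variable u : H.
Hypothesis ub : rtransl b u = u.

Lemma invariant_b x : u (x * b)%g = u x.
Proof. by rewrite -[in RHS]ub. Qed.

Lemma invariant_bV x : u (x * b^-1)%g = u x.
Proof. by rewrite -invariant_b !simpG. Qed.

Lemma invariant_rotg x p : u (x * rotg p)%g = u x.
Proof. by case: p => [[]|] /=; rewrite ?invariant_b ?invariant_bV ?mulg1. Qed.

Lemma invariant_exit x : u (exit x) = u x.
Proof. by rewrite -(invariant_rotg _ (pos x)) exitK. Qed.

(** Of the three [a]-edges at a triangle, one leads to the parent and two to the children. Which
    corner is the exit depends on [pos x], but the sum does not. *)
Lemma shiftD_coshift x : S u x + C u x =
  u (x * a)%g + u (x * b * a)%g + u (x * b^-1 * a)%g.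
Proof.
rewrite shiftE coshiftE /= /gparent /gchild !invariant_rotg invariant_exit /exit.
by case: (pos x) => [[]|] /=; rewrite ?invgK ?invg1 ?mulg1 ?simpG; ring.
Qed.

End Invariant.

(* Schur complement with respect to the range of [avg]: off that range
   [z - L] is [c + A / 2] with [c = z - 5 / 4], whose inverse is
   [(c - A / 2) / (c ^ 2 - 1 / 4)]. *)
Definition half_sub c f : H := c *: f - 2^-1 *: rtransl a f.

Lemma half_subE c f x : half_sub c f x = c * f x - 2^-1 * f (x * a)%g.
Proof. by []. Qed.

Lemma rnorm_half_sub c f : N (half_sub c f) <= (normc c + 1) * N f.
Proof.
apply: (le_trans (ell2_rnormB _ _)); rewrite !ell2_rnormZ rnorm_rtransl mulrDl mul1r.
rewrite lerD2l ler_piMl ?ell2_rnorm_ge0//.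
by rewrite Normc.normcV normc_nat; lra.
Qed.

(** The parameter [t = 8 (z - 7 / 8) ^ 2 - 25 / 8] in terms of [c = z - 5 / 4]. *)
Definition shift_param c : R[i] := 8 * (c ^+ 2 - 4^-1) + 6 * c.

Definition tree_sub c f : H := shift_param c *: f - S f - C f.
Definition lap_sub c f : H := L f - (c + 5 / 4) *: f.

Lemma lap_subE c f x : lap_sub c f x =
  - (c * f x + 2^-1 * f (x * a)%g + 4^-1 * (f x + f (x * b)%g + f (x * b^-1)%g)).
Proof. by rewrite !(ell2E, rtranslE); field. Qed.

Lemma tree_sub_branching c f x : tree_sub c f x = shift_param c * f x -
  f (gparent x) - (f (gchild false x) + f (gchild true x)).
Proof. by []. Qed.

Lemma tree_subE c f x : rtransl b f = f -> tree_sub c f x =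
  shift_param c * f x - (f (x * a)%g + f (x * b * a)%g + f (x * b^-1 * a)%g).
Proof.
by move=> fb; rewrite -shiftD_coshift// [in RHS]opprD [RHS]addrA.
Qed.

Local Opaque avg half_sub lap_sub.

(** As [A ^ 2 = 1], applying [c - A / 2] to [z - L = c + A / 2 + 3 P / 4] gives
    [c ^ 2 - 1 / 4 + 3 / 4 (c - A / 2) P]; averaging and multiplying by [8] leaves
    [t P - 3 P A P]. *)
Lemma tree_sub_avg c f :
  tree_sub c (avg f) = - 8 *: avg (half_sub c (lap_sub c f)).
Proof.
apply: ell2_ext => x; rewrite tree_subE ?avg_invariant// [RHS]ell2Z.
by rewrite !(lap_subE, half_subE, avgE, simpG) /shift_param; field.
Qed.

(** The same product before averaging: it recovers [f] from [lap_sub c f] and [avg f] when [c ^ 2]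
    is not [1 / 4]. *)
Lemma half_sub_lap_sub c f : (c ^+ 2 - 4^-1) *: f =
  - half_sub c (lap_sub c f) - (3 / 4) *: half_sub c (avg f).
Proof.
apply: ell2_ext => x.
change ((c ^+ 2 - 4^-1) * f x =
  - half_sub c (lap_sub c f) x - 3 / 4 * half_sub c (avg f) x).
rewrite (half_subE c (lap_sub c f)) (half_subE c (avg f)).
rewrite !(lap_subE c f) !avgE !simpG.
by field.
Qed.

Lemma lap_sub_half_sub c u : rtransl b u = u ->
  lap_sub c (half_sub c u) = - 8^-1 *: tree_sub c u.
Proof.
move=> ub; apply: ell2_ext => x.
rewrite [RHS]ell2Z tree_subE// !(lap_subE, half_subE, simpG).
by rewrite (invariant_b ub) (invariant_bV ub) /shift_param; field.
Qed.

Lemma half_subK c u : half_sub (- c) (half_sub c u) = - (c ^+ 2 - 4^-1) *: u.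
Proof.
by apply: ell2_ext => x; rewrite [RHS]ell2Z !(half_subE, simpG); field.
Qed.

Lemma tree_sub_rtransl c u : tree_sub c (rtransl b u) = rtransl b (tree_sub c u).
Proof.
apply: ell2_ext => x; rewrite rtranslE !tree_sub_branching.
by rewrite !gchild_b !gparent_b.
Qed.

Lemma tree_subB c f g : tree_sub c (f - g) = tree_sub c f - tree_sub c g.
Proof.
apply: ell2_ext => x; rewrite [RHS]ell2D [in RHS]ell2N !tree_sub_branching.
have E y : (f - g) y = f y - g y by [].
by rewrite !E; ring.
Qed.

(** For the lower bound, [tree_sub_avg] controls [avg f] and then [half_sub_lap_sub] controls [f].
    For surjectivity, the tree equation is solved for the average of the solution. *)
Lemma invertible_lap_sub c : c ^+ 2 - 4^-1 != 0 ->
  invertible (tree_sub c) -> invertible (lap_sub c).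
Proof.
set d := _ - _ => d0 [[K TK] Ts]; split.
  pose m := normc c + 1.
  have m0 : 0 <= m by rewrite addr_ge0 ?normc_ge0.
  exists (normc d^-1 * (m + normc (3 / 4) * (m * (`|K| * (normc (- 8) * m))))) => f.
  set g := lap_sub c f.
  have uK : N (avg f) <= `|K| * (normc (- 8) * m) * N g.
    apply: (le_trans (TK _)); apply: (@le_trans _ _ (`|K| * N (tree_sub c (avg f)))).
      by rewrite ler_wpM2r ?ell2_rnorm_ge0// ler_norm.
    rewrite -!mulrA ler_wpM2l// tree_sub_avg ell2_rnormZ ler_wpM2l ?normc_ge0//.
    exact: (le_trans (rnorm_avg _) (rnorm_half_sub _ _)).
  have -> : f = d^-1 *: (d *: f) by rewrite scalerA mulVf// scale1r.
  rewrite ell2_rnormZ -mulrA ler_wpM2l ?normc_ge0// half_sub_lap_sub.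
  apply: (le_trans (ell2_rnormB _ _)); rewrite ell2_rnormN [leRHS]mulrDl lerD//.
    exact: rnorm_half_sub.
  rewrite ell2_rnormZ -mulrA ler_wpM2l ?normc_ge0//.
  by apply: (le_trans (rnorm_half_sub _ _)); rewrite -mulrA ler_wpM2l.
move=> g; have [u uP] := Ts (- 8 *: avg (half_sub c g)).
(* The translate of [u] solves the same equation, whose solution is unique by the lower bound. *)
have ub : rtransl b u = u.
  apply/eqP; rewrite -subr_eq0; apply/eqP/ell2_rnorm_eq0/le_anti.
  rewrite ell2_rnorm_ge0 andbT; apply: (le_trans (TK _)).
  rewrite tree_subB tree_sub_rtransl uP linearZ /= avg_invariant subrr.
  by rewrite ell2_rnorm0 mulr0.
(* The value that [half_sub_lap_sub] dictates if [lap_sub c f = g] and [avg f = u]. *)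
pose f := d^-1 *: half_sub c (- g - (3 / 4) *: u).
have fE y : f y = d^-1 * (c * (- g y - 3 / 4 * u y) -
    2^-1 * (- g (y * a)%g - 3 / 4 * u (y * a)%g)) by [].
exists f; apply: ell2_ext => x; change (lap_sub c f x = g x).
have uPx : shift_param c * u x - (u (x * a)%g + u (x * b * a)%g + u (x * b^-1 * a)%g) =
    - 8 * avg (half_sub c g) x by rewrite -tree_subE// uP.
rewrite avgE !half_subE /shift_param in uPx.
have avgf : avg f x = u x.
  have cancel p q r : d * (3^-1 * (d^-1 * p + d^-1 * q + d^-1 * r)) =
    3^-1 * (p + q + r) by field.
  apply: (mulfI d0); rewrite avgE !fE !(invariant_b ub) !(invariant_bV ub) cancel.
  apply: (@mulfI _ (8 : R[i])); first by rewrite pnatr_eq0.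
  apply/eqP; rewrite -subr_eq0; apply/eqP.
  move/eqP: uPx; rewrite -subr_eq0 => /eqP uPx.
  by rewrite -[RHS]oppr0 -[in RHS]uPx /d; field.
have -> : lap_sub c f x = - (c * f x + 2^-1 * f (x * a)%g + 3 / 4 * avg f x).
  by rewrite lap_subE avgE; field.
have cancel p q r : - (c * (d^-1 * p) + 2^-1 * (d^-1 * q) + r) =
  d^-1 * - (c * p + 2^-1 * q + d * r) by field.
rewrite avgf !fE !simpG cancel; apply: (mulfI d0); rewrite mulVKf//.
by rewrite /d; field.
Qed.

(** The lower bound of [lap_sub c] is applied to [half_sub c u], whose image is a multiple of
    [tree_sub c u]; [half_sub (- c)] then recovers [u]. *)
Lemma bounded_below_tree_sub c : c ^+ 2 - 4^-1 != 0 -> invertible (lap_sub c) ->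
  exists K : R, forall u, rtransl b u = u -> N u <= K * N (tree_sub c u).
Proof.
set d := _ - _ => d0 [[K LK] _].
have d0' : - d != 0 by rewrite oppr_eq0.
exists (normc (- d)^-1 * ((normc (- c) + 1) * (`|K| * normc (- 8^-1)))) => u ub.
have -> : N u = N ((- d)^-1 *: (- d *: u)) by rewrite scalerA mulVf// scale1r.
rewrite -half_subK ell2_rnormZ -mulrA ler_wpM2l ?normc_ge0//.
apply: (le_trans (rnorm_half_sub _ _)); rewrite -mulrA ler_wpM2l ?addr_ge0 ?normc_ge0//.
apply: (le_trans (LK _)); rewrite lap_sub_half_sub// ell2_rnormZ -mulrA.
by rewrite ler_wpM2r ?mulr_ge0 ?ell2_rnorm_ge0 ?normc_ge0// ler_norm.
Qed.

Lemma dirac1_subproof : (fun x : G => if x \in [set 1%g] then 1 else 0) \in @ell2_pred R G.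
Proof. by apply/ell2_predP/sqsum_const_lty. Qed.

Definition dirac1 : H := Ell2 dirac1_subproof.

Lemma dirac1_pos x : pos x != None -> dirac1 x = 0.
Proof.
move=> xp; rewrite /= ifF//; apply: contraNF xp.
by rewrite inE => /= ->; rewrite pos1.
Qed.

Lemma dirac1_1 : dirac1 1%g = 1.
Proof. by rewrite /= ifT// inE. Qed.

Lemma not_invertible_lap_sub (al : R[i]) c : c ^+ 2 - 4^-1 != 0 ->
  2 * normc al ^+ 2 = 1 -> shift_param c = 2 * al + al^-1 ->
  ~ invertible (lap_sub c).
Proof.
move=> d0 al2 cal /(bounded_below_tree_sub d0); rewrite /tree_sub cal.
(* A nonzero [b]-invariant element of the kernel of [coshift]. Invariance under [b] is the property
   that the partial sums must preserve, since the lower bound holds for invariant functions. *)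
pose g : H := twist modular_branching (S (avg dirac1)).
apply: (shift_not_bounded_below (g := g)) => //.
- exact: coshift_twist.
- apply/eqP => /(congr1 N); rewrite rnorm_twist ell2_rnorm0 => S0.
  have := sqr_rnorm_shift modular_branching (avg dirac1).
  rewrite S0 expr0n => /esym/eqP; rewrite mulf_eq0 pnatr_eq0/= sqrf_eq0 => /eqP.
  (* At [1] the average is [1 / 3]: [b] and [b^-1] differ from [1] because their positions do. *)
  move/ell2_rnorm_eq0 => /(congr1 (fun h : H => h 1%g)); rewrite avgE dirac1_1.
  rewrite !dirac1_pos ?pos_b ?pos_bV ?pos1// !addr0 mulr1 => /eqP.
  by rewrite invr_eq0 pnatr_eq0.
- by rewrite linear0.
move=> h hb; rewrite linearD linearZ /= -[in RHS]hb; congr (_ + _ *: _).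
  apply: ell2_ext => x; rewrite rtranslE !twistE !shiftE /= gparent_b.
  by rewrite /gsibling exit_b (invariant_b (avg_invariant _)).
by apply: ell2_ext => x; rewrite rtranslE !shiftE rtranslE /= gparent_b.
Qed.

Lemma mask_subproof f : (fun x => if pos x is None then f x else 0) \in @ell2_pred R G.
Proof.
apply/ell2_predP; apply: le_lt_trans (elimT (ell2_predP _) (ell2_mem f)).
by apply: le_sqsum => x; case: (pos x) => //; rewrite Normc.normc0 normc_ge0.
Qed.

Definition mask f : H := Ell2 (mask_subproof f).

Lemma maskE f x : mask f x = if pos x is None then f x else 0. Proof. by []. Qed.

(* An eigenfunction sums to zero over each triangle and is multiplied by [eta]
   across each [a]-edge. These conditions amount to a recursion along the
   branching for its values at the exits, solved by a Neumann series. *)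
Lemma eigenfunction (eta : R[i]) : eta ^+ 2 = 1 ->
  exists2 f, f != 0 & L f = (5 / 4 - eta / 2) *: f.
Proof.
move=> eta2.
have neta : normc eta = 1.
  apply/eqP; rewrite -(@eqrXn2 _ 2) ?normc_ge0// expr1n.
  by rewrite expr2 -Normc.normcM -expr2 eta2 Normc.normc1.
have linE : linear (fun f => - (eta / 2) *: S f).
  by move=> l u v; rewrite linearP scalerDr !scalerA mulrC.
pose E : {linear H -> H} := HB.pack (fun f => - (eta / 2) *: S f)
  (GRing.isLinear.Build _ _ _ _ _ linE).
have neta2 : 2 * normc (- (eta / 2)) ^+ 2 = 2^-1.
  by rewrite normcN Normc.normcM neta mul1r Normc.normcV normc_nat; field.
have S2 f : N (S f) ^+ 2 <= 2 * N f ^+ 2 by rewrite sqr_rnorm_shift.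
have q01 : 0 <= Num.sqrt (2 * normc (- (eta / 2)) ^+ 2) < 1.
  by rewrite sqrtr_ge0 -[ltRHS]sqrtr1 ltr_sqrt// neta2; lra.
have [_ /(_ (eta *: twist modular_branching (S dirac1)))[h hP]] :=
  @invertible_sub1 R G E _ q01 (scaled_rnorm_le _ S2).
have hE x : h x = - (eta / 2) * h (gparent x) + eta *
    (if gsibling x then - dirac1 (gparent x) else dirac1 (gparent x)).
  have := congr1 (fun k : H => k x) hP; rewrite !ell2E twistE !shiftE /=.
  by move=> <-; rewrite addrC subrK.
(* On the triangle with exit [e], the values at [e], [e b] and [e b^-1] are [h e],
   [- h e / 2 + dirac1 e] and [- h e / 2 - dirac1 e]. They sum to zero, and [hE] is the condition
   across the edge to the parent. *)
pose f : H := mask h + rtransl b^-1%g (- 2^-1 *: mask h + mask dirac1)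
  + rtransl b (- 2^-1 *: mask h - mask dirac1).
have fE x : f x = mask h x + (- 2^-1 * mask h (x * b^-1)%g + mask dirac1 (x * b^-1)%g)
  + (- 2^-1 * mask h (x * b)%g - mask dirac1 (x * b)%g) by [].
have f0 x : f x + f (x * b)%g + f (x * b^-1)%g = 0 by rewrite !fE !simpG; field.
have fa0 x : pos x = None -> f (x * a)%g = eta * f x.
  move=> x0; have xa := pos_exit_a x; rewrite exit_id// in xa.
  rewrite !fE !maskE !pos_b !pos_bV x0 xa (hE x).
  have gp : gparent x = exit (x * a)%g by rewrite /gparent (exit_id x0) x0 /= mulg1.
  have etaM (p : R[i]) : eta * (eta * p) = p by rewrite mulrA -expr2 eta2 mul1r.
  rewrite gp /exit xa; rewrite -[LHS]etaM; congr (_ * _).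
  by case: (gsibling x) => /=; rewrite ?invgK; field.
have fa x : f (x * a)%g = eta * f x.
  case E1 : (pos x) => [c|]; last exact: fa0.
  have := fa0 _ (pos_a E1); rewrite modular_aK => ->.
  by rewrite mulrA -expr2 eta2 mul1r.
exists f.
  (* Vanishing at [1] forces [h 1 = 0], and then the value at [b] is [1]. *)
  apply/eqP => f00; have fx x : f x = 0 by rewrite f00.
  have := fx 1%g; rewrite fE !maskE !pos_b !pos_bV pos1/= oppr0 !mulr0 !addr0 => h1.
  have := fx (1 * b)%g; rewrite fE !maskE !simpG ?pos_b ?pos_bV pos1 h1 dirac1_1.
  rewrite /= mulr0 !add0r !subr0 ?addr0.
  by move/eqP; rewrite oner_eq0.
apply: ell2_ext => x; rewrite laplacianE fa ell2Z.
have -> : f (x * b^-1)%g = - (f x + f (x * b)%g).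
  by apply/eqP; rewrite -addr_eq0 addrC f0.
by field.
Qed.

End ModularLaplacian.

(** * From the tree parameter to intervals of the real line *)

Section Spectrum.
Variable R : realType.
Local Notation normc := (@Normc.normc R).
Local Notation L := (@laplacian R modular_group modular_a modular_b).
Implicit Types (z t al : R[i]) (x tau : R).

Lemma resolvent_lap_subP z : resolvent_set L z <-> invertible (lap_sub (z - 5 / 4)).
Proof.
suff -> : lap_sub (z - 5 / 4) = fun f => L f - z *: f by exact: resolvent_ell2P.
by apply/funext => f; rewrite /lap_sub subrK.
Qed.

Lemma spectrum_eigenvalue eta : eta ^+ 2 = 1 ->
  spectrum L (5 / 4 - eta / 2).
Proof.
move=> /(eigenfunction (R := R))[f f0 fL] /resolvent_ell2P[[K fK] _].
have : ell2_rnorm f <= K * ell2_rnorm (L f - (5 / 4 - eta / 2) *: f) := fK f.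
rewrite fL subrr ell2_rnorm0 mulr0 => f_le0.
move/eqP: f0; apply; apply: ell2_rnorm_eq0; apply/le_anti.
by rewrite f_le0 ell2_rnorm_ge0.
Qed.

(** The equation is [2 al ^ 2 - t al + 1 = 0], with roots [(t + s) / 4] and [(t - s) / 4]; their
    product is [1 / 2], so one of them has [2 |al| ^ 2 <= 1]. *)
Lemma shift_param_root t : exists al, [/\ al != 0, t = 2 * al + al^-1 &
  2 * normc al ^+ 2 <= 1].
Proof.
pose s := sqrtC (t ^+ 2 - 8); have s2 : s ^+ 2 = t ^+ 2 - 8 by rewrite sqrtCK.
have ab : (t + s) / 4 * ((t - s) / 4) = 2^-1.
  have -> : (t + s) / 4 * ((t - s) / 4) = (t ^+ 2 - s ^+ 2) / 16 by field.
  by rewrite s2; field.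
have key al be : al * be = 2^-1 -> al + be = t / 2 ->
    al != 0 /\ t = 2 * al + al^-1.
  move=> alb tE; have al0 : al != 0.
    apply/eqP => al0; move/eqP: alb; rewrite al0 mul0r eq_sym invr_eq0.
    by rewrite pnatr_eq0.
  split => //; apply: (mulfI al0); rewrite mulrDr divff//.
  have -> : t = 2 * (al + be) by rewrite tE; field.
  transitivity (al * (2 * al) + 2 * (al * be)); first by ring.
  by rewrite alb; field.
have nab : normc ((t + s) / 4) * normc ((t - s) / 4) = 2^-1.
  by rewrite -Normc.normcM ab Normc.normcV normc_nat.
have [le1|gt1] := leP (2 * normc ((t + s) / 4) ^+ 2) 1.
  by exists ((t + s) / 4); have [|? ?] := key _ _ ab; first field.
exists ((t - s) / 4); rewrite mulrC in ab.
have [|al0 tE] := key _ _ ab; first by field.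
split => //; move: nab gt1.
move: (normc_ge0 ((t + s) / 4)) (normc_ge0 ((t - s) / 4)).
move: (normc ((t + s) / 4)) (normc ((t - s) / 4)) => p q p0 q0 pq p2.
rewrite -(@ler_pM2l _ (2 * p ^+ 2)); last by rewrite (lt_trans ltr01).
rewrite mulr1; apply: le_trans (ltW p2).
have -> : 2 * p ^+ 2 * (2 * q ^+ 2) = 4 * (p * q) ^+ 2 by ring.
by rewrite pq; lra.
Qed.

(** On this circle [1 / al] is twice the conjugate of [al], so [t] is four times the real part of
    [al]. *)
Lemma shift_param_circle t : (exists al, 2 * normc al ^+ 2 = 1 /\ t = 2 * al + al^-1) <->
  exists2 tau, - (2 * Num.sqrt 2) <= tau <= 2 * Num.sqrt 2 & t = tau%:C%C.
Proof.
have s2 : Num.sqrt 2 ^+ 2 = 2 :> R by rewrite sqr_sqrtr.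
have s0 : 0 <= Num.sqrt 2 :> R by exact: sqrtr_ge0.
split=> [[[p q] []]|[tau tau2 ->]].
  rewrite /= sqr_sqrtr ?addr_ge0 ?sqr_ge0// => pq ->.
  exists (4 * p); last first.
    have pq0 : (p +i* q)%C != 0.
      apply/eqP => -[p0 q0]; move: pq; rewrite p0 q0 expr0n addr0 mulr0.
      by move/esym/eqP; rewrite oner_eq0.
    apply: (mulfI pq0); rewrite mulrDr divff//.
    apply/eqP; rewrite eq_complex /=; apply/andP; split; apply/eqP; nra.
  have q2 := sqr_ge0 q; rewrite -ler_norml -ler_sqr ?nnegrE ?mulr_ge0//.
  rewrite real_normK ?num_real// !exprMn s2; lra.
pose q := Num.sqrt (2^-1 - (tau / 4) ^+ 2).
have q2 : q ^+ 2 = 2^-1 - (tau / 4) ^+ 2.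
  by rewrite sqr_sqrtr// subr_ge0; move: tau2 => /andP[? ?]; nra.
exists (tau / 4 +i* q)%C; split.
  by rewrite /= sqr_sqrtr ?addr_ge0 ?sqr_ge0// q2; field.
have pq0 : (tau / 4 +i* q)%C != 0.
  apply/eqP => -[p0 q0]; move: q2; rewrite q0 p0; lra.
apply: (mulfI pq0); rewrite mulrDr divff//.
by apply/eqP; rewrite eq_complex /=; apply/andP; split; apply/eqP; nra.
Qed.

Lemma spectrum_laplacianP z : spectrum L z <-> [\/ z = 3 / 4, z = 7 / 4 |
  exists2 tau, - (2 * Num.sqrt 2) <= tau <= 2 * Num.sqrt 2 &
    shift_param (z - 5 / 4) = tau%:C%C].
Proof.
have fac : (z - 5 / 4) ^+ 2 - 4^-1 = (z - 3 / 4) * (z - 7 / 4) by field.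
have spec3 : spectrum L (3 / 4).
  have -> : 3 / 4 = 5 / 4 - 1 / 2 :> R[i] by field.
  by apply: spectrum_eigenvalue; rewrite expr1n.
have spec7 : spectrum L (7 / 4).
  have -> : 7 / 4 = 5 / 4 - (-1) / 2 :> R[i] by field.
  by apply: spectrum_eigenvalue; rewrite sqrrN expr1n.
split=> [Lz|[->//|->//|/shift_param_circle[al [al2 zal]]]].
  have [->|z3] := eqVneq z (3 / 4); first by constructor 1.
  have [->|z7] := eqVneq z (7 / 4); first by constructor 2.
  constructor 3; apply/shift_param_circle.
  have [al [al0 zal]] := shift_param_root (shift_param (z - 5 / 4)).
  rewrite le_eqVlt => /orP[/eqP al2|al2]; first by exists al.
  exfalso; apply: Lz; apply/resolvent_lap_subP; apply: invertible_lap_sub.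
    by rewrite fac mulf_neq0// subr_eq0.
  by rewrite /tree_sub zal; exact: invertible_resolvent_shift.
(* The two zeros of [c ^ 2 - 1 / 4] are already known to be eigenvalues; elsewhere the Schur
   complement applies. *)
have [->//|z3] := eqVneq z (3 / 4); have [->//|z7] := eqVneq z (7 / 4).
move/resolvent_lap_subP; apply: not_invertible_lap_sub al2 zal.
by rewrite fac mulf_neq0// subr_eq0.
Qed.

(** The bands are where [r0 <= |x - 7 / 8| <= r1]. The bounds [1 / 8 < r0] and [r1 < 7 / 8] keep
    them away from [3 / 4] and [7 / 4]; both follow from [sqrt 2 < 3 / 2]. *)
Lemma lambda_radii : exists r0 r1 : R, [/\ lambda0 R = 7 / 8 - r1,
  lambda1 R = 7 / 8 + r0, 8^-1 < r0 < r1 & [/\ r1 < 7 / 8,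
  8 * r0 ^+ 2 - 25 / 8 = - (2 * Num.sqrt 2) & 8 * r1 ^+ 2 - 25 / 8 = 2 * Num.sqrt 2]].
Proof.
have s2 : Num.sqrt 2 ^+ 2 = 2 :> R by rewrite sqr_sqrtr.
have s0 : 0 <= Num.sqrt 2 :> R by exact: sqrtr_ge0.
have s32 : Num.sqrt 2 < 3 / 2 :> R.
  by rewrite -ltr_sqr ?nnegrE// s2; lra.
have s1 : 0 < Num.sqrt 2 :> R by rewrite sqrtr_gt0.
pose r0 : R := 2^-1 * Num.sqrt (25 / 16 - Num.sqrt 2).
pose r1 : R := 2^-1 * Num.sqrt (25 / 16 + Num.sqrt 2).
have r00 : 0 <= r0 by rewrite mulr_ge0// sqrtr_ge0.
have r10 : 0 <= r1 by rewrite mulr_ge0// sqrtr_ge0.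
have r02 : r0 ^+ 2 = 4^-1 * (25 / 16 - Num.sqrt 2).
  by rewrite exprMn sqr_sqrtr; [congr (_ * _); field | lra].
have r12 : r1 ^+ 2 = 4^-1 * (25 / 16 + Num.sqrt 2).
  by rewrite exprMn sqr_sqrtr; [congr (_ * _); field | lra].
exists r0, r1; split => //; last first.
  by split; [rewrite -ltr_sqr ?nnegrE// r12; lra
    | rewrite r02; field | rewrite r12; field].
by apply/andP; split; rewrite -ltr_sqr ?nnegrE// r02 ?r12; lra.
Qed.

Lemma shift_paramE z :
  shift_param (z - 5 / 4) = 8 * (z - (7 / 8)%:C%C) ^+ 2 - (25 / 8)%:C%C.
Proof.
have -> : (7 / 8)%:C%C = 7 / 8 :> R[i] by rewrite fmorph_div /= !rmorph_nat.
have -> : (25 / 8)%:C%C = 25 / 8 :> R[i] by rewrite fmorph_div /= !rmorph_nat.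
by rewrite /shift_param; field.
Qed.

Lemma shift_param_real z : (exists2 tau, - (2 * Num.sqrt 2) <= tau <= 2 * Num.sqrt 2 &
    shift_param (z - 5 / 4) = tau%:C%C) <->
  exists2 x, x \in `[lambda0 R, 7 / 4 - lambda1 R] \/ x \in `[lambda1 R, 7 / 4 - lambda0 R]
    & x%:C%C = z.
Proof.
have [r0 [r1 [-> -> /andP[r0p r01] [r1l r02 r12]]]] := lambda_radii.
rewrite shift_paramE; split=> [[tau /andP[tau1 tau2] ztau]|[x xI <-]]; last first.
  exists (8 * (x - 7 / 8) ^+ 2 - 25 / 8).
    rewrite -r02 -r12 !lerD2r !ler_pM2l//.
    by case: xI; rewrite in_itv /= => /andP[x1 x2]; apply/andP; split; nra.
  by rewrite [RHS]rmorphB; congr (_ - _);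
    rewrite [RHS]rmorphM rmorphXn rmorphB rmorph_nat.
have w2 : (z - (7 / 8)%:C%C) ^+ 2 = ((tau + 25 / 8) / 8)%:C%C.
  have w8 : 8 * (z - (7 / 8)%:C%C) ^+ 2 = (tau + 25 / 8)%:C%C.
    by rewrite [RHS]rmorphD /= -ztau subrK.
  apply: (@mulfI _ (8 : R[i])); first by rewrite pnatr_eq0.
  rewrite w8 -(rmorph_nat (real_complex R) 8) -rmorphM /=; congr (_%:C%C).
  by field.
move: w2; case: z ztau => p q _; rewrite expr2 => -[w1 w2].
(* The square of [z - 7 / 8] is real and positive, so [z] is real. *)
have q0 : q = 0.
  apply/eqP; have : (p - 7 / 8) * q = 0 by rewrite oppr0 addr0 in w2; lra.
  move/eqP; rewrite mulf_eq0 => /orP[/eqP u0|//].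
  by exfalso; rewrite oppr0 addr0 u0 in w1; nra.
exists p; last by rewrite q0.
move: w1; rewrite q0 oppr0 addr0 mulr0 subr0 -expr2 => w1.
rewrite !in_itv /=.
have ub : `|p - 7 / 8| <= r1.
  rewrite -ler_sqr ?nnegrE//; last by lra.
  by rewrite real_normK ?num_real// w1; lra.
have lb : r0 <= `|p - 7 / 8|.
  rewrite -ler_sqr ?nnegrE//; last by lra.
  by rewrite real_normK ?num_real// w1; lra.
have [p0|p0] := leP 0 (p - 7 / 8).
  by rewrite ger0_norm// in ub lb; right; apply/andP; split; lra.
by rewrite ltr0_norm// in ub lb; left; apply/andP; split; lra.
Qed.

End Spectrum.

(** * The spectrum as a disjoint union of two bands and two points *)

Theorem corollary1p1 (R : realType) :
  let I0 : set R := `[lambda0 R, 7 / 4 - lambda1 R]%classic in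
  let I1 : set R := `[lambda1 R, 7 / 4 - lambda0 R]%classic in
  spectrum (@laplacian R modular_group modular_a modular_b) =
    [set x%:C%C | x in I0 `|` [set 3 / 4] `|` I1 `|` [set 7 / 4]] /\
  trivIset setT (nth set0 [:: I0; [set 3 / 4]; I1; [set 7 / 4]]).
Proof.
move=> I0 I1.
have E34 : (3 / 4)%:C%C = 3 / 4 :> R[i] by rewrite fmorph_div /= !rmorph_nat.
have E74 : (7 / 4)%:C%C = 7 / 4 :> R[i] by rewrite fmorph_div /= !rmorph_nat.
split.
  apply/seteqP; split=> [z /spectrum_laplacianP|_ [x xI <-]].
    case=> [->|->|/shift_param_real[x xI <-]].
    - by exists (3 / 4) => //; left; left; right.
    - by exists (7 / 4) => //; right.
    by exists x => //; left; case: xI => xI; [left; left|right].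
  apply/spectrum_laplacianP; case: xI => [[[xI|->]|xI]|->].
  - by constructor 3; apply/shift_param_real; exists x => //; left.
  - by constructor 1.
  - by constructor 3; apply/shift_param_real; exists x => //; right.
  - by constructor 2.
have [r0 [r1 [l0 l1 /andP[r0p r01] [r1l _ _]]]] := lambda_radii R.
have I0P x : I0 x -> 7 / 8 - r1 <= x <= 7 / 8 - r0.
  by rewrite /I0 /= in_itv /= l0 l1 => /andP[? ?]; apply/andP; split; lra.
have I1P x : I1 x -> 7 / 8 + r0 <= x <= 7 / 8 + r1.
  by rewrite /I1 /= in_itv /= l0 l1 => /andP[? ?]; apply/andP; split; lra.
apply/trivIsetP => i j _ _; wlog: i j / (i < j)%N.
  move=> W; rewrite neq_ltn => /orP[ij|ji]; first by apply: W => //; rewrite ltn_eqF.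
  by rewrite setIC; apply: W => //; rewrite ltn_eqF.
clear E34 E74; move=> ij _; apply/seteqP; split=> // x []; move: ij.
(* Indices from [4] on give the default [set0]; the other pairs are separated by linear inequalities
   in [r0] and [r1]. *)
case: i => [|[|[|[|i]]]]; case: j => [|[|[|[|j]]]] //= _;
  rewrite ?nth_nil //;
  do ?[move=> /I0P /andP[? ?]|move=> /I1P /andP[? ?]|move=> ?]; exfalso; lra.
Qed.
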